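(* Let $H$ be a compact quantum group equipped with the inner product $\langle x,y\rangle=\varphi(S(y^\circ)x)$ given by the normal integral $\varphi$. Then: (1) The Nakayama automorphism $\mathcal{N}$ is a positive operator with respect to $\langle\cdot,\cdot\rangle$. Moreover, it preserves the decomposition of $H$ in simple components $H_\rho$. (2) The Nakayama automorphism commutes with $\circ$. (3) If $\alpha:H\to\mathbb{C}$ is the modular function, then $\alpha\star\mathrm{id}:H\to H$ is a positive operator with respect to the inner product $\langle\cdot,\cdot\rangle$.
   Context: Everything is over $\mathbb{C}$. A $\circ$-structure on a coalgebra is a conjugate linear involution $c\mapsto c^\circ$ with $\Delta(c^\circ)=\sum c_2^\circ\otimes c_1^\circ$. A $\circ$-Hopf algebra is a Hopf algebra $H$ with a $\circ$-structure on its coalgebra such that $(xy)^\circ=x^\circ y^\circ$. A unitary inner product on a right $H$-comodule $V$ (coaction $v\mapsto\sum v_0\otimes v_1$) is an inner product (linear in the first, conjugate linear in the second variable) with $\sum\langle u_0,v\rangle u_1=\sum\langle u,v_0\rangle v_1^\circ$ for all $u,v$. A compact quantum group is a $\circ$-Hopf algebra such that every right $H$-comodule admits a unitary inner product. Such an $H$ is cosemisimple: $H=\bigoplus_{\rho}H_\rho$ with $H_\rho$ the simple subcoalgebras (simple components); the normal integral $\varphi:H\to\mathbb{C}$ is the projection onto the component $\mathbb{C}1\cong\mathbb{C}$. With $S$ the antipode, $\langle x,y\rangle=\varphi(S(y^\circ)x)$ is an inner product on $H$. An operator $L$ on $H$ is positive if it is selfadjoint and $\langle L(x),x\rangle>0$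 for all $x\ne0$. The Nakayama automorphism $\mathcal{N}$ is the algebra automorphism of $H$ characterized by $\varphi(xy)=\varphi(y\,\mathcal{N}(x))$ for all $x,y\in H$. The modular function is $\alpha=\varepsilon\mathcal{N}$. For $\tau\in H^*$, $(\tau\star\mathrm{id})(x)=\sum\tau(x_1)x_2$. *)

(* Defs.v *)
From HB Require Import structures.
From mathcomp Require Import all_boot all_order all_algebra sesquilinear.
From mathcomp Require Import boolp classical_sets reals.
From mathcomp.real_closed Require Import complex.

Set Implicit Arguments.
Unset Strict Implicit.
Unset Printing Implicit Defensive.

Import Order.TTheory GRing.Theory Num.Theory.
Local Open Scope classical_set_scope.
Local Open Scope ring_scope.

(* The base field is C = R[i] with R : realType; an element [s] of
   [seq (U * V)] stands for the tensor \sum_(p <- s) p.1 (x) p.2 of U (x) V.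
   Two such sums denote the same tensor iff every bilinear map out of U x V
   takes the same value on them (universal property of U (x) V). Maps into
   tensor products are only ever used through this equality, so the choice of
   the representing sums is immaterial, as in Sweedler's notation. *)
Section Tensors.
Variable K : comNzRingType.

Definition tensor_eq (U V : lmodType K) (s t : seq (U * V)) : Prop :=
  forall (W : lmodType K) (f : {bilinear U -> V -> W}),
    \sum_(p <- s) f p.1 p.2 = \sum_(p <- t) f p.1 p.2.

Definition trilinear (U V W X : lmodType K) (f : U -> V -> W -> X) : Prop :=
  [/\ forall v w, linear (fun u => f u v w),
      forall u w, linear (fun v => f u v w)
    & forall u v, linear (fun w => f u v w)].

Definition tensor3_eq (U V W : lmodType K) (s t : seq (U * V * W)) : Prop :=
  forall (X : lmodType K) (f : U -> V -> W -> X), trilinear f ->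
    \sum_(p <- s) f p.1.1 p.1.2 p.2 = \sum_(p <- t) f p.1.1 p.1.2 p.2.

(* a map U -> V (x) W given by representing sums is linear *)
Definition tensor_linear (U V W : lmodType K) (d : U -> seq (V * W)) : Prop :=
  forall a x y,
    tensor_eq (d (a *: x + y)) ([seq (a *: p.1, p.2) | p <- d x] ++ d y).

End Tensors.

Section Hopf.
Variable R : realType.
Local Notation C := R[i].

Record coalgebra (H : lmodType C) := Coalgebra {
  comul : H -> seq (H * H);
  counit : {scalar H};
  comul_linear : tensor_linear comul;
  comulA : forall x,
    tensor3_eq [seq (q.1, q.2, p.2) | p <- comul x, q <- comul p.1]
               [seq (p.1, q.1, q.2) | p <- comul x, q <- comul p.2];
  counitl : forall x, \sum_(p <- comul x) counit p.1 *: p.2 = x;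
  counitr : forall x, \sum_(p <- comul x) counit p.2 *: p.1 = x
}.

Record hopf_algebra (H : algType C) := HopfAlgebra {
  hopf_coalgebra :> coalgebra H;
  comul1 : tensor_eq (comul hopf_coalgebra 1) [:: (1, 1)];
  comulM : forall x y,
    tensor_eq (comul hopf_coalgebra (x * y))
      [seq (p.1 * q.1, p.2 * q.2) | p <- comul hopf_coalgebra x,
                                    q <- comul hopf_coalgebra y];
  counit1 : counit hopf_coalgebra 1 = 1;
  counitM : {morph counit hopf_coalgebra : x y / x * y};
  antipode : {linear H -> H};
  antipodel : forall x,
    \sum_(p <- comul hopf_coalgebra x) antipode p.1 * p.2 =
      (counit hopf_coalgebra x)%:A;
  antipoder : forall x,
    \sum_(p <- comul hopf_coalgebra x) p.1 * antipode p.2 =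
      (counit hopf_coalgebra x)%:A
}.

Record circ_structure (H : lmodType C) (D : coalgebra H) := CircStructure {
  circ_map :> {linear H -> H | Num.conj \; *:%R};
  circ_mapK : involutive circ_map;
  circ_comul : forall x,
    tensor_eq (comul D (circ_map x))
      [seq (circ_map p.2, circ_map p.1) | p <- comul D x]
}.

Record circ_hopf_algebra (H : algType C) := CircHopfAlgebra {
  circ_hopf :> hopf_algebra H;
  circ : circ_structure circ_hopf;
  circM : {morph circ : x y / x * y}
}.

Record right_comodule (H : lmodType C) (D : coalgebra H) (V : lmodType C) :=
  RightComodule {
  coact :> V -> seq (V * H);
  coact_linear : tensor_linear coact;
  coactA : forall v,
    tensor3_eq [seq (q.1, q.2, p.2) | p <- coact v, q <- coact p.1]
               [seq (p.1, q.1, q.2) | p <- coact v, q <- comul D p.2];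
  coact_counit : forall v, \sum_(p <- coact v) counit D p.2 *: p.1 = v
}.

(* [{dot V for Num.conj}] is linear in the first variable and conjugate linear
   in the second. *)
Definition unitary_inner_product (H : algType C) (X : circ_hopf_algebra H)
    (V : lmodType C) (rho : right_comodule X V)
    (ip : {dot V for Num.conj}) : Prop :=
  forall u v, \sum_(p <- rho u) ip p.1 v *: p.2 =
              \sum_(p <- rho v) ip u p.1 *: circ X p.2.

Definition compact_quantum_group (H : algType C) (X : circ_hopf_algebra H)
    : Prop :=
  forall (V : lmodType C) (rho : right_comodule X V),
    exists ip : {dot V for Num.conj}, unitary_inner_product rho ip.

Definition subcoalgebra (H : lmodType C) (D : coalgebra H) (A : set H)
    : Prop :=
  submod_closed [in A] /\
  forall x, A x -> exists2 s : seq (H * H),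
    tensor_eq (comul D x) s & forall p, p \in s -> A p.1 /\ A p.2.

Definition simple_subcoalgebra (H : lmodType C) (D : coalgebra H) (A : set H)
    : Prop :=
  [/\ subcoalgebra D A, A <> [set 0]
    & forall B, subcoalgebra D B -> B `<=` A -> B = [set 0] \/ B = A].

(* The projection onto the component C1 along the other simple components;
   when H is the direct sum of its simple subcoalgebras, as it is for a compact
   quantum group, these conditions determine [phi]. *)
Definition normal_integral (H : algType C) (X : hopf_algebra H)
    (phi : {scalar H}) : Prop :=
  phi 1 = 1 /\
  forall A, simple_subcoalgebra X A -> A <> range (fun a : C => a%:A : H) ->
    forall x, A x -> phi x = 0.

Definition integral_form (H : algType C) (X : circ_hopf_algebra H)
    (phi : {scalar H}) (x y : H) : C :=
  phi (antipode X (circ X y) * x).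

Definition positive_operator (H : lmodType C) (ip : H -> H -> C) (L : H -> H)
    : Prop :=
  [/\ linear L, forall x y, ip (L x) y = ip x (L y)
    & forall x, x != 0 -> 0 < ip (L x) x].

Definition nakayama_automorphism (H : algType C) (phi : {scalar H})
    (N : {lrmorphism H -> H}) : Prop :=
  bijective N /\ forall x y, phi (x * y) = phi (y * N x).

Definition modular_function (H : algType C) (X : hopf_algebra H)
    (N : {lrmorphism H -> H}) (x : H) : C :=
  counit X (N x).

Definition star_id (H : lmodType C) (D : coalgebra H) (tau : H -> C) (x : H)
    : H :=
  \sum_(p <- comul D x) tau p.1 *: p.2.

End Hopf.

(* Main.v *)
Require Import Defs.
From HB Require Import structures.
From mathcomp Require Import all_boot all_order all_algebra sesquilinear.
From mathcomp Require Import spectral.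
From mathcomp Require Import boolp classical_sets reals.
From mathcomp.real_closed Require Import complex.

Set Implicit Arguments.
Unset Strict Implicit.
Unset Printing Implicit Defensive.

Import Order.TTheory GRing.Theory Num.Theory.
Local Open Scope classical_set_scope.
Local Open Scope ring_scope.

(* Let (x, y) be a unitary inner product on the right comodule H. The functional
   psi(x) = (x, 1) / (1, 1) is right invariant, its conjugate by circ is left
   invariant, so the two agree: psi is a real two-sided Haar functional. A
   Gram-Schmidt argument puts every element of H in the span of the entries of a
   unitary corepresentation matrix u (u_ij^circ = u_ji), and diagonalizing
   hermitian intertwiners reduces to u with scalar commutant. For such u the
   functional psi satisfies psi(u_ij S(u_lk)) = delta_ik h_jl, and h is positive
   definite because it is proportional to the Gram matrix of a unitary inner
   product on the dual comodule, whose matrix is S(u_ji). Hence the form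
   [x, y] = psi(x S(y^circ)) is an inner product on H, the span of the u_ij is a
   simple subcoalgebra, H is the orthogonal sum of these, and phi = psi. The
   theorem now follows from <N x, y> = [x, y] and from alpha * id = S^2 N, which
   gives <(alpha * id)(x), y> = [y^circ, x^circ]. *)

(** * Linear maps and inner products *)

Section LinearMaps.
Variable K : comNzRingType.
Implicit Types U V W : lmodType K.

Lemma lin_id U : linear (fun x : U => x).
Proof. by []. Qed.

Lemma lin_comp U V W (g : V -> W) (f : U -> V) :
  linear g -> linear f -> linear (fun x => g (f x)).
Proof. by move=> lg lf a x y; rewrite lf lg. Qed.

Lemma lin_fun U V (F : {linear U -> V}) : linear F.
Proof. exact: linearP. Qed.

Lemma lin_scalar U (F : {scalar U}) : linear (F : U -> K^o).
Proof. exact: scalarP. Qed.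

Lemma lin_scale U V (c : K) (f : U -> V) :
  linear f -> linear (fun x => c *: f x).
Proof. by move=> lf a x y; rewrite lf scalerDr !scalerA mulrC. Qed.

Lemma lin_scalel U V (f : U -> K) (v : V) :
  linear (f : U -> K^o) -> linear (fun x => f x *: v).
Proof. by move=> lf a x y; rewrite lf scalerDl scalerA. Qed.

Lemma lin_sum U V I (r : seq I) (P : pred I) (f : I -> U -> V) :
  (forall i, linear (f i)) -> linear (fun x => \sum_(i <- r | P i) f i x).
Proof.
move=> lf a x y; rewrite scaler_sumr -big_split; apply: eq_bigr => i _.
exact: lf.
Qed.

Lemma linear0f U V (f : U -> V) : linear f -> f 0 = 0.
Proof.
move=> lf; have := lf 1 0 0; rewrite !scale1r addr0 => /eqP.
by rewrite -subr_eq subrr eq_sym => /eqP.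
Qed.

Lemma linearZf U V (f : U -> V) a x : linear f -> f (a *: x) = a *: f x.
Proof. by move=> lf; have := lf a x 0; rewrite !addr0 linear0f // addr0. Qed.

Lemma linearDf U V (f : U -> V) x y : linear f -> f (x + y) = f x + f y.
Proof. by move=> lf; have := lf 1 x y; rewrite !scale1r. Qed.

Lemma linear_sumf U V (f : U -> V) I (r : seq I) (P : pred I) F :
  linear f -> f (\sum_(i <- r | P i) F i) = \sum_(i <- r | P i) f (F i).
Proof.
move=> lf; apply: (big_morph f) => [x y|]; last exact: linear0f.
exact: linearDf.
Qed.

Definition bilin U V W (f : U -> V -> W) :=
  (forall v, linear (f ^~ v)) /\ (forall u, linear (f u)).

(** Packing an unbundled bilinear map lets tensor equalities be evaluated on plain functions. *)
Lemma tensor_eq_bilin U V (s t : seq (U * V)) :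
  tensor_eq s t <-> forall W (f : U -> V -> W), bilin f ->
    \sum_(p <- s) f p.1 p.2 = \sum_(p <- t) f p.1 p.2.
Proof.
split=> [st W f [fl fr]|st W f]; last first.
  by apply: st; split=> ? a x y; rewrite ?linearPl ?linearPr.
pose bf : bilinear_for *:%R *:%R f := (fl, fr).
pose F := HB.pack_for {bilinear U -> V -> W} f
  (bilinear_isBilinear.Build K U V W _ _ f bf).
exact: (st W F).
Qed.

End LinearMaps.

Section LinearAlg.
Variables (K : comNzRingType) (U : lmodType K) (A : algType K).

Lemma lin_mull (f : U -> A) (z : A) : linear f -> linear (fun x => f x * z).
Proof. by move=> lf a x y; rewrite lf mulrDl scalerAl. Qed.

Lemma lin_mulr (f : U -> A) (z : A) : linear f -> linear (fun x => z * f x).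
Proof. by move=> lf a x y; rewrite lf mulrDr scalerAr. Qed.

End LinearAlg.

(** Placeholder, redefined once [lin_sw] is proved so that [lin] also descends into Sweedler
    sums. *)
Ltac lin_hook := fail.

Ltac lin :=
  match goal with
  | |- bilin _ => split; intro; cbv beta; lin
  | |- @trilinear _ _ _ _ _ _ => split; do 2 intro; cbv beta; lin
  | |- forall _, _ => intro; cbv beta; lin
  | |- _ => first
    [ exact: lin_id
    | assumption
    | exact: lin_fun
    | exact: lin_scalar
    | eassumption
    | match goal with h : forall _, _ |- _ => exact: h end
    | match goal with h : bilin _ |- _ =>
        first [exact: (proj1 h) | exact: (proj2 h)] end
    | lin_hook; lin
    | apply: lin_sum; lin
    | apply: lin_mull; lin
    | apply: lin_mulr; lin
    | apply: lin_scalel; lin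
    | apply: lin_scale; lin
    | match goal with
      | h : bilin ?f |- @GRing.linear_for _ _ _ _ (fun x => ?f ?a (@?g x)) =>
          apply: (@lin_comp _ _ _ _ _ g (proj2 h a)); lin
      | h : bilin ?f |- @GRing.linear_for _ _ _ _ (fun x => ?f (@?g x) ?a) =>
          apply: (@lin_comp _ _ _ _ _ g (proj1 h a)); lin
      | |- @GRing.linear_for _ _ _ _ (fun x => ?f (@?g x)) =>
          apply: (@lin_comp _ _ _ _ f g); lin
      end ]
  end.

(** * Hermitian forms, orthonormal families and Riesz representation *)

Section InnerProduct.
Variable R : realType.
Local Notation C := R[i].
Variable V : lmodType C.

(** Separated from positivity because [haar_form] is handled as a hermitian form before it is known
    to be definite. *)
Record hermitian_form (ip : V -> V -> C) : Prop := HermitianForm {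
  ip_linear : forall y, linear (ip ^~ y : V -> C^o);
  ip_sym : forall x y, ip y x = (ip x y)^*
}.

Record inner_product (ip : V -> V -> C) : Prop := InnerProduct {
  inner_product_hermitian :> hermitian_form ip;
  ip_gt0 : forall x, x != 0 -> 0 < ip x x
}.

Lemma dot_inner_product (ip : {dot V for Num.conj}) : inner_product ip.
Proof.
split=> [|x]; last exact: neq0_dnorm_gt0.
by split=> [y a x z|x y]; [rewrite linearPl | rewrite hermC expr0 mul1r].
Qed.

Definition subspace (P : V -> Prop) :=
  P 0 /\ forall a x y, P x -> P y -> P (a *: x + y).

Lemma subspaceZ P a x : subspace P -> P x -> P (a *: x).
Proof. by case=> P0 PD Px; rewrite -[a *: x]addr0; apply: PD. Qed.

Lemma subspaceD P x y : subspace P -> P x -> P y -> P (x + y).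
Proof. by case=> P0 PD Px Py; rewrite -[x]scale1r; apply: PD. Qed.

Lemma subspaceB P x y : subspace P -> P x -> P y -> P (x - y).
Proof.
by case=> P0 PD Px Py; rewrite addrC -scaleN1r; apply: PD.
Qed.

Lemma subspace_sum P I (r : seq I) (Q : pred I) (F : I -> V) :
  subspace P -> (forall i, Q i -> P (F i)) -> P (\sum_(i <- r | Q i) F i).
Proof.
by move=> sP PF; apply: big_ind => // [|x y]; [case: sP | exact: subspaceD].
Qed.

Section HermitianForm.
Variable ip : V -> V -> C.
Hypothesis ipP : hermitian_form ip.

Lemma ipZl a x y : ip (a *: x) y = a * ip x y.
Proof. by rewrite (linearZf _ _ (ip_linear ipP y)). Qed.

Lemma ipDl x x' y : ip (x + x') y = ip x y + ip x' y.
Proof. by rewrite (linearDf _ _ (ip_linear ipP y)). Qed.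

Lemma ip_suml I (r : seq I) (P : pred I) F y :
  ip (\sum_(i <- r | P i) F i) y = \sum_(i <- r | P i) ip (F i) y.
Proof. by rewrite (linear_sumf _ _ _ (ip_linear ipP y)). Qed.

Lemma ipZr a x y : ip x (a *: y) = a^* * ip x y.
Proof. by rewrite (ip_sym ipP) ipZl rmorphM /= -(ip_sym ipP). Qed.

Lemma ip_sumr I (r : seq I) (P : pred I) F x :
  ip x (\sum_(i <- r | P i) F i) = \sum_(i <- r | P i) ip x (F i).
Proof.
rewrite (ip_sym ipP) ip_suml rmorph_sum; apply: eq_bigr => i _.
by rewrite [RHS](ip_sym ipP).
Qed.

End HermitianForm.

Variable ip : V -> V -> C.
Hypothesis ipP : inner_product ip.
Let ipl := ip_linear ipP.
Let ipS := ip_sym ipP.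
Let ipZl := ipZl ipP.
Let ipZr := ipZr ipP.
Let ipDl := ipDl ipP.
Let ip_suml := ip_suml ipP.
Let ip_sumr := ip_sumr ipP.

(** Induction on the list: the residual of a new vector is either zero, or normalized and put in
    front. Quantifying over subspaces makes any linear property of the list pass to the orthonormal
    family. *)
Lemma gram_schmidt (s : seq V) : exists n (e : 'I_n -> V),
  [/\ forall i j, ip (e i) (e j) = (i == j)%:R,
      forall P, subspace P -> (forall a, a \in s -> P a) -> forall i, P (e i)
    & forall a, a \in s -> a = \sum_i ip a (e i) *: e i].
Proof.
elim: s => [|a s [n [e [orth span dec]]]].
  by exists 0%N, (fun=> 0); split=> [[]|P _ _ []|].
pose r := a - \sum_i ip a (e i) *: e i.
have spanP P : subspace P -> (forall b, b \in a :: s -> P b) ->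
    (forall i, P (e i)) /\ P r.
  move=> sP Ps.
  have Pe := span P sP (fun b bs => Ps b (@mem_behead _ (a :: s) b bs)).
  split=> //; apply: subspaceB => //; first exact: Ps (mem_head _ _).
  by apply: subspace_sum => // i _; apply: subspaceZ.
have rE j : ip r (e j) = 0.
  rewrite /r -scaleN1r ipDl ipZl ip_suml (bigD1 j) //= big1 => [|i ij].
    by rewrite ipZl orth eqxx mulr1 addr0 mulN1r subrr.
  by rewrite ipZl orth (negPf ij) mulr0.
have [r0|r0] := eqVneq r 0.
  exists n, e; split=> // [P sP Ps|b]; first by case: (spanP P sP Ps).
  rewrite inE => /orP[/eqP->|/dec//].
  by apply/eqP; rewrite -subr_eq0; apply/eqP.
have r_gt0 : 0 < ip r r by exact: (ip_gt0 ipP).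
pose c := (sqrtC (ip r r))^-1.
have cc : c * c * ip r r = 1.
  by rewrite /c -invfM -expr2 sqrtCK mulVf // gt_eqF.
have cR : c^* = c.
  by apply/CrealP; rewrite realV ger0_real // sqrtC_ge0 ltW.
pose e' (i : 'I_n.+1) := if unlift ord0 i is Some j then e j else c *: r.
have e'0 : e' ord0 = c *: r by rewrite /e' unlift_none.
have e'S i : e' (lift ord0 i) = e i by rewrite /e' liftK.
exists n.+1, e'; split=> [i j|P sP Ps i|b].
- case: (unliftP ord0 i) => [i'|] ->; case: (unliftP ord0 j) => [j'|] ->;
    rewrite ?e'0 ?e'S ?orth ?(inj_eq lift_inj) //.
  + by rewrite ipZr ipS rE rmorph0 mulr0 eq_sym (negPf (neq_lift _ _)).
  + by rewrite ipZl rE mulr0 (negPf (neq_lift _ _)).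
  + by rewrite ipZl ipZr cR mulrA cc eqxx.
- have [Pe Pr] := spanP P sP Ps.
  by case: (unliftP ord0 i) => [i'|] ->; rewrite ?e'S ?e'0 //; apply: subspaceZ.
(* The expansion along [e'] is the projection onto the line of [r] plus the expansion along [e], so
   only [ip x r] remains to be found. *)
have tailE x : \sum_i ip x (e' i) *: e' i =
    (c * c * ip x r) *: r + \sum_i ip x (e i) *: e i.
  rewrite big_ord_recl e'0 ipZr cR scalerA mulrAC; congr (_ + _).
  by apply: eq_bigr => i _; rewrite e'S.
rewrite tailE inE => /orP[/eqP->|bs]; last first.
  suff -> : ip b r = 0 by rewrite mulr0 scale0r add0r; apply: dec.
  rewrite [b]dec // ip_suml big1 // => i _.
  by rewrite ipZl (ipS r) rE rmorph0 mulr0.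
have -> : ip a r = ip r r.
  rewrite {2}/r -scaleN1r ipDl ipZl ip_suml [X in - 1 * X]big1 ?mulr0 ?addr0 //.
  by move=> i _; rewrite ipZl (ipS r) rE rmorph0 mulr0.
by rewrite cc scale1r subrK.
Qed.

(** The representing vector is built from an orthonormal family for the span of the list. It is
    applied to the legs of tensors and to a basis, which are finite lists. *)
Lemma riesz (tau : V -> C) (s : seq V) : linear (tau : V -> C^o) ->
  exists w, forall a, a \in s -> tau a = ip a w.
Proof.
move=> ltau; have [n [e [orth _ dec]]] := gram_schmidt s.
exists (\sum_i (tau (e i))^* *: e i) => a /dec aE.
rewrite {1}aE (linear_sumf _ _ _ ltau) ip_sumr; apply: eq_bigr => i _.
by rewrite (linearZf _ _ ltau) ipZr conjCK mulrC.
Qed.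

End InnerProduct.

(** * Coefficients of unitary corepresentations *)

Section Coalgebra.
Variable R : realType.
Local Notation C := R[i].
Variables (H : lmodType C) (D : coalgebra H).

(* [sw x f] is the Sweedler sum of [f x_1 x_2]. *)
Definition sw (x : H) (W : lmodType C) (f : H -> H -> W) : W :=
  \sum_(p <- comul D x) f p.1 p.2.

Lemma eq_sw x (W : lmodType C) (f g : H -> H -> W) :
  (forall a b, f a b = g a b) -> sw x f = sw x g.
Proof. by move=> fg; apply: eq_bigr => p _; apply: fg. Qed.

Lemma lin_sw (W : lmodType C) (f : H -> H -> W) :
  bilin f -> linear (fun x => sw x f).
Proof.
move=> fb a x y; rewrite /sw; have /tensor_eq_bilin-> // := comul_linear D a x y.
rewrite big_cat big_map scaler_sumr; congr (_ + _).
by apply: eq_bigr => p _; rewrite (linearZf _ _ (fb.1 p.2)).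
Qed.

Lemma sw_linear (W W' : lmodType C) (g : W -> W') (f : H -> H -> W) x :
  linear g -> g (sw x f) = sw x (fun a b => g (f a b)).
Proof. exact: linear_sumf. Qed.

Lemma sw_assoc (W : lmodType C) (f : H -> H -> H -> W) x : trilinear f ->
  sw x (fun a b => sw a (fun c d => f c d b)) =
  sw x (fun a b => sw b (fun c d => f a c d)).
Proof. by move=> ft; have := @comulA _ _ D x _ _ ft; rewrite !big_allpairs_dep. Qed.

Lemma sw_counitl (W : lmodType C) (g : H -> W) x :
  linear g -> sw x (fun a b => counit D a *: g b) = g x.
Proof.
move=> lg; rewrite -[in RHS](counitl D x) (linear_sumf _ _ _ lg).
by apply: eq_bigr => p _; rewrite (linearZf _ _ lg).
Qed.

Lemma sw_counitr (W : lmodType C) (g : H -> W) x :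
  linear g -> sw x (fun a b => counit D b *: g a) = g x.
Proof.
move=> lg; rewrite -[in RHS](counitr D x) (linear_sumf _ _ _ lg).
by apply: eq_bigr => p _; rewrite (linearZf _ _ lg).
Qed.

(** The tensor identity $\Delta(u_{ij}) = \sum_k u_{ik} \otimes u_{kj}$ is tested on all bilinear
    maps. *)
Definition corep n (u : 'I_n -> 'I_n -> H) : Prop :=
  (forall i j (W : lmodType C) (f : H -> H -> W), bilin f ->
     sw (u i j) f = \sum_k f (u i k) (u k j)) /\
  (forall i j, counit D (u i j) = (i == j)%:R).

End Coalgebra.

Ltac lin_hook ::= apply: lin_sw.

(** * Unitary matrix coefficients span the Hopf algebra *)

Section CoefficientMatrices.
Variable R : realType.
Local Notation C := R[i].
Variables (H : algType C) (X : circ_hopf_algebra H).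
Local Notation sw := (sw X).
Local Notation eps := (counit X).
Local Notation S := (antipode X).

Lemma circP a x y : circ X (a *: x + y) = a^* *: circ X x + circ X y.
Proof. exact: linearP. Qed.

Lemma circ0 : circ X 0 = 0.
Proof.
have := circP 1 0 0; rewrite conjC1 !scale1r addr0 => /eqP.
by rewrite -subr_eq subrr eq_sym => /eqP.
Qed.

Lemma circZ a x : circ X (a *: x) = a^* *: circ X x.
Proof. by have := circP a x 0; rewrite !addr0 circ0 addr0. Qed.

Lemma circD x y : circ X (x + y) = circ X x + circ X y.
Proof. by have := circP 1 x y; rewrite conjC1 !scale1r. Qed.

Lemma circ_sum I (r : seq I) (P : pred I) F :
  circ X (\sum_(i <- r | P i) F i) = \sum_(i <- r | P i) circ X (F i).
Proof. exact: (big_morph _ circD circ0). Qed.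

Lemma circK : involutive (circ X).
Proof. exact: circ_mapK. Qed.

Lemma circ1 : circ X 1 = 1.
Proof. by rewrite -[LHS]mulr1 -{2}[1]circK -circM mul1r circK. Qed.

Lemma circ_alg a : circ X a%:A = (a^*)%:A.
Proof. by rewrite circZ circ1. Qed.

(** For the star $x \mapsto S(x^\circ)$, the second condition says that the star of $u_{ij}$ is
    $S(u_{ji})$, which is the usual unitarity. *)
Definition ucorep n (u : 'I_n -> 'I_n -> H) : Prop :=
  corep X u /\ forall i j, circ X (u i j) = u j i.

(** Unitarity for the comodule [H] whose coaction is the comultiplication. *)
Definition unitary_form (ip : H -> H -> C) : Prop :=
  forall x y, sw x (fun a b => ip a y *: b) =
              sw y (fun a b => ip x a *: circ X b).

Variable ip : H -> H -> C.
Hypotheses (ipP : inner_product ip) (ipU : unitary_form ip).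

(** Since $\Delta(x)$ is a finite sum, [x] lies in a finite-dimensional subcomodule. Its
    coefficients in an orthonormal basis [e] form [u]; unitarity of the form gives the [circ]
    relation, and the counit recovers [x] from the entries. *)
Lemma span_ucorep x : exists n (u : 'I_n -> 'I_n -> H), ucorep u /\
  exists c : 'I_n -> 'I_n -> C, x = \sum_i \sum_j c i j *: u i j.
Proof.
have ipl := ip_linear ipP.
have [m [g [_ _ gP]]] := gram_schmidt ipP [seq p.2 | p <- comul X x].
(* With these first legs, $\Delta(x) = \sum_k a_k \otimes g_k$. *)
pose a k : H := sw x (fun b c => ip c (g k) *: b).
have swx (W : lmodType C) (f : H -> H -> W) : bilin f ->
    sw x f = \sum_k f (a k) (g k).
  move=> fb; rewrite /sw [LHS]big_seq.
  under eq_bigr => p px.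
    rewrite {1}[p.2](gP _ (map_f _ px)) (linear_sumf _ _ _ (fb.2 _)).
  over.
  rewrite -big_seq exchange_big; apply: eq_bigr => k _.
  rewrite [RHS](sw_linear _ _ _ (fb.1 _)).
  apply: eq_bigr => p _.
  by rewrite (linearZf _ _ (fb.2 _)) (linearZf _ _ (fb.1 _)).
(* Coassociativity of $\Delta(x)$, paired with [g i] in the last leg, gives $\Delta(a_i) = \sum_k
   a_k \otimes t_{ki}$: the [a k] span a subcomodule. *)
pose t k i : H := sw (g k) (fun c d => ip d (g i) *: c).
have swa i (W : lmodType C) (f : H -> H -> W) : bilin f ->
    sw (a i) f = \sum_k f (a k) (t k i).
  move=> fb; rewrite {1}/a (@sw_linear _ _ X _ _ (fun y => sw y f));
    last exact: lin_sw.
  under eq_sw => b c.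
    rewrite (linearZf _ _ (lin_sw _ fb)) /sw scaler_sumr -/(sw _ _).
  over.
  rewrite (@sw_assoc _ _ X _ (fun b1 b2 c => ip c (g i) *: f b1 b2)); last by lin.
  rewrite swx; last first.
    split=> [v|y]; first by lin.
    by lin.
  apply: eq_bigr => k _; rewrite /t (sw_linear _ _ _ (fb.2 _)).
  by apply: eq_sw => c d; rewrite (linearZf _ _ (fb.2 _)).
have [n [e [orth span eP]]] := gram_schmidt ipP [seq a k | k <- enum 'I_m].
have {}eP k : a k = \sum_i ip (a k) (e i) *: e i.
  by apply: eP; apply: map_f; rewrite mem_enum.
(* The vectors whose comultiplication lies in the span of the [a k] tensored with [H]; being a
   subspace that contains every [a k], it contains every [e j]. *)
pose P (v : H) := exists w : 'I_m -> H, forall (W : lmodType C)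
  (f : H -> H -> W), bilin f -> sw v f = \sum_k f (a k) (w k).
have sP : subspace P.
  split=> [|b y z [w wP] [w' w'P]].
    exists (fun=> 0) => W f fb; rewrite (linear0f (lin_sw _ fb)) big1 // => k _.
    exact: linear0f (fb.2 _).
  exists (fun k => b *: w k + w' k) => W f fb.
  rewrite (lin_sw _ fb) wP // w'P // scaler_sumr -big_split; apply: eq_bigr => k _.
  by rewrite (fb.2 _).
pose u m j : H := sw (e j) (fun b c => ip b (e m) *: c).
have uP j (W : lmodType C) (f : H -> H -> W) : bilin f ->
    sw (e j) f = \sum_m f (e m) (u m j).
  move=> fb; have [w wP] : P (e j).
    by apply: span => // b /mapP[k _ ->]; exists (t^~ k) => W' f'; apply: swa.
  rewrite wP //.
  under eq_bigr => k _ do rewrite {1}[a k]eP (linear_sumf _ _ _ (fb.1 _)).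
  rewrite exchange_big; apply: eq_bigr => i _.
  rewrite /u wP; last by lin.
  rewrite (linear_sumf _ _ _ (fb.2 _)); apply: eq_bigr => k _.
  by rewrite (linearZf _ _ (fb.1 _)) (linearZf _ _ (fb.2 _)).
have epsu i j : eps (u i j) = (i == j)%:R.
  rewrite /u (@sw_linear _ _ X _ C^o eps); last exact: lin_scalar.
  under eq_sw => b c do rewrite linearZ /= mulrC.
  rewrite (@sw_counitr _ _ X C^o (ip^~ (e i))) //.
  by rewrite orth eq_sym.
exists n, u; split; first (split; first split=> //).
- move=> i j W f fb.
  rewrite {1}/u (@sw_linear _ _ X _ _ (fun y => sw y f)); last exact: lin_sw.
  under eq_sw => b c.
    rewrite (linearZf _ _ (lin_sw _ fb)) /sw scaler_sumr -/(sw _ _).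
  over.
  rewrite -(@sw_assoc _ _ X _ (fun b c d => ip b (e i) *: f c d)); last by lin.
  rewrite (uP j); last first.
    split=> [v|y]; last by lin.
    by lin.
  apply: eq_bigr => k _; rewrite /u (sw_linear _ _ _ (fb.1 _)).
  by apply: eq_sw => c d; rewrite (linearZf _ _ (fb.1 _)).
- move=> i j; rewrite /u ipU /sw circ_sum; apply: eq_bigr => p _.
  by rewrite circZ circK -(ip_sym ipP).
have spanx : exists c, x = \sum_i c i *: e i.
  exists (fun i => \sum_k eps (g k) * ip (a k) (e i)).
  rewrite -[LHS](@sw_counitr _ _ X H idfun) // swx; last by lin.
  under eq_bigr => k _ do rewrite {1}[a k]eP scaler_sumr.
  rewrite exchange_big; apply: eq_bigr => i _; rewrite scaler_suml.
  by apply: eq_bigr => k _; rewrite scalerA.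
have [c ->] := spanx.
(* The counit on the first leg of $\Delta(e_j) = \sum_i e_i \otimes u_{ij}$ gives $e_j = \sum_i
   \varepsilon(e_i) u_{ij}$. *)
exists (fun i j => eps (e i) * c j).
rewrite exchange_big; apply: eq_bigr => j _.
rewrite -{1}[e j](@sw_counitl _ _ X H idfun) // uP; last by lin.
by rewrite scaler_sumr; apply: eq_bigr => i _; rewrite scalerA mulrC.
Qed.

End CoefficientMatrices.

(** * The antipode and the Haar functional *)

Lemma sum_only (V : nmodType) (I : finType) (F : I -> V) j :
  (forall i, i != j -> F i = 0) -> \sum_i F i = F j.
Proof. by move=> F0; rewrite (bigD1 j) //= big1 ?addr0. Qed.

Lemma sum_delta_mull (K : pzRingType) (I : finType)
    (F : I -> K) j : \sum_i (i == j)%:R * F i = F j.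
Proof.
by rewrite (sum_only (j := j)) ?eqxx ?mul1r // => i /negPf->; rewrite mul0r.
Qed.

Lemma sum_delta_mulr (K : pzRingType) (I : finType)
    (F : I -> K) j : \sum_i F i * (i == j)%:R = F j.
Proof.
by rewrite (sum_only (j := j)) ?eqxx ?mulr1 // => i /negPf->; rewrite mulr0.
Qed.

(** Associativity of the matrix product $FEG$ over a noncommutative ring. It stands in for
    uniqueness of convolution inverses. *)
Lemma left_right_inverse (K : pzRingType) (I : finType) (F E G : I -> I -> K) :
  (forall i j, \sum_k F i k * E k j = (i == j)%:R) ->
  (forall i j, \sum_k E i k * G k j = (i == j)%:R) ->
  forall i j, F i j = G i j.
Proof.
move=> FE EG i j; rewrite -[LHS](sum_delta_mulr (fun k => F i k)).
under eq_bigr => k _ do rewrite -EG mulr_sumr.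
rewrite exchange_big /= -[RHS](sum_delta_mull (fun l => G l j)).
apply: eq_bigr => l _; rewrite eq_sym -FE mulr_suml.
by apply: eq_bigr => k _; rewrite mulrA.
Qed.

Section Antipode.
Variable R : realType.
Local Notation C := R[i].
Variables (H : algType C) (X : circ_hopf_algebra H).
Local Notation sw := (sw X).
Local Notation eps := (counit X).
Local Notation S := (antipode X).

Hypothesis spanU : forall x, exists n (u : 'I_n -> 'I_n -> H), ucorep X u /\
  exists c : 'I_n -> 'I_n -> C, x = \sum_i \sum_j c i j *: u i j.

(** Linear identities need only be checked on matrix entries, which turns Sweedler calculus into
    matrix calculus. *)
Lemma ucorep_ext (W : lmodType C) (f g : H -> W) : linear f -> linear g ->
  (forall n (u : 'I_n -> 'I_n -> H), ucorep X u ->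
     forall i j, f (u i j) = g (u i j)) ->
  forall x, f x = g x.
Proof.
move=> lf lg fg x; have [n [u [uP [c ->]]]] := spanU x.
rewrite !(linear_sumf _ _ _ lf, linear_sumf _ _ _ lg); apply: eq_bigr => i _.
rewrite !(linear_sumf _ _ _ lf, linear_sumf _ _ _ lg); apply: eq_bigr => j _.
by rewrite (linearZf _ _ lf) (linearZf _ _ lg) (fg _ _ uP).
Qed.

Lemma sw1 (W : lmodType C) (f : H -> H -> W) : bilin f -> sw 1 f = f 1 1.
Proof.
move=> fb; have /tensor_eq_bilin E := comul1 X.
by rewrite /sw E // big_seq1.
Qed.

Lemma swM (W : lmodType C) (f : H -> H -> W) x y : bilin f ->
  sw (x * y) f = sw x (fun a b => sw y (fun c d => f (a * c) (b * d))).
Proof.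
move=> fb; have /tensor_eq_bilin E := comulM X x y.
by rewrite /sw E // big_allpairs_dep.
Qed.

Lemma sw_corepM m n (u : 'I_m -> 'I_m -> H) (v : 'I_n -> 'I_n -> H)
    (W : lmodType C) (f : H -> H -> W) i j k l :
  corep X u -> corep X v -> bilin f ->
  sw (u i j * v k l) f = \sum_p \sum_q f (u i p * v k q) (u p j * v q l).
Proof.
move=> uP vP fb; rewrite swM // uP.1; last by lin.
by apply: eq_bigr => p _; rewrite vP.1 //; lin.
Qed.

Lemma natrA n : (n%:R : C)%:A = n%:R :> H.
Proof. by rewrite scaler_nat. Qed.

Lemma antipode_corepl n (u : 'I_n -> 'I_n -> H) i j : corep X u ->
  \sum_k S (u i k) * u k j = (i == j)%:R.
Proof.
move=> [uD ue]; rewrite -(uD i j H (fun a b => S a * b)); last by lin.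
by rewrite /sw antipodel ue natrA.
Qed.

Lemma antipode_corepr n (u : 'I_n -> 'I_n -> H) i j : corep X u ->
  \sum_k u i k * S (u k j) = (i == j)%:R.
Proof.
move=> [uD ue]; rewrite -(uD i j H (fun a b => a * S b)); last by lin.
by rewrite /sw antipoder ue natrA.
Qed.

Lemma antipode1 : S 1 = 1.
Proof.
have := antipodel X 1; rewrite -/(sw 1 (fun a b => S a * b)) sw1; last by lin.
by rewrite mulr1 counit1 scale1r.
Qed.

(** On entries of [u] and [v], both sides invert the matrix $u_{ac} v_{bd}$ indexed by pairs. *)
Lemma antipodeM x y : S (x * y) = S y * S x.
Proof.
apply: (ucorep_ext (f := fun x => S (x * y)) (g := fun x => S y * S x)) => {x};
  [by lin | by lin | move=> m u [uP _] i j].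
apply: (ucorep_ext (f := fun y => S (u i j * y)) (g := fun y => S y * S (u i j)))
  => {y}; [by lin | by lin | move=> n v [vP _] k l].
pose F (p q : 'I_m * 'I_n) := S (u p.1 q.1 * v p.2 q.2).
pose E (p q : 'I_m * 'I_n) := u p.1 q.1 * v p.2 q.2.
pose G (p q : 'I_m * 'I_n) := S (v p.2 q.2) * S (u p.1 q.1).
apply: (@left_right_inverse H _ F E G _ _ (i, k) (j, l))
  => [[a b] [c d]|[a b] [c d]].
- rewrite -(pair_bigA _ (fun p q => S (u a p * v b q) * (u p c * v q d))) /=.
  have := antipodel X (u a c * v b d).
  rewrite -/(sw _ (fun x y => S x * y)) (sw_corepM _ _ _ _ uP vP); last by lin.
  by rewrite counitM uP.2 vP.2 -natrM natrA mulnb -xpair_eqE => ->.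
- rewrite -(pair_bigA _ (fun p q => (u a p * v b q) * (S (v q d) * S (u p c)))) /=.
  under eq_bigr => p _.
    under eq_bigr => q _ do rewrite -mulrA [v b q * _]mulrA.
    rewrite -mulr_sumr -mulr_suml antipode_corepr // mulr_natl mulrnAr.
  over.
  by rewrite sumrMnl antipode_corepr // -mulrnA mulnb xpair_eqE.
Qed.

(** On entries, both sides describe the inverse of the matrix $\Delta(u)$ over $H \otimes H$; the
    usual uniqueness argument is carried out after evaluation by [f]. *)
Lemma sw_antipode (W : lmodType C) (f : H -> H -> W) x : bilin f ->
  sw (S x) f = sw x (fun a b => f (S b) (S a)).
Proof.
move=> fb.
apply: (ucorep_ext (f := fun x => sw (S x) f)
  (g := fun x => sw x (fun a b => f (S b) (S a)))) => {x}.
- exact: (lin_comp (lin_sw _ fb) (lin_fun _)).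
- by lin.
move=> n u [uP _] i j; rewrite uP.1; last by lin.
(* Evaluation by [f] of the product $\Delta(z)(p \otimes q)$. *)
pose D z p q := sw z (fun c d => f (c * p) (d * q)).
have lD z : bilin (D z) by rewrite /D; lin.
have lD1 p q : linear (fun z => D z p q) by lin.
have DM z a b p q : D (z * u a b) p q = \sum_m D z (u a m * p) (u m b * q).
  rewrite /D swM; last by lin.
  rewrite [RHS]exchange_big; apply: eq_bigr => r _ /=.
  rewrite uP.1; last by lin.
  by apply: eq_bigr => m _; rewrite !mulrA.
have -> : sw (S (u i j)) f = \sum_a D (S (u i a)) (a == j)%:R 1.
  rewrite (sum_only (j := j)) => [|a /negPf->].
    by rewrite eqxx /D; apply: eq_sw => c d; rewrite !mulr1.
  exact: linear0f ((lD _).1 _).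
(* Kronecker deltas in the two legs are expanded as [u] times [S u]; contracting over [m] then
   rebuilds $\Delta(u_{ab})$, which [S (u i a)] cancels. *)
transitivity (\sum_a \sum_m \sum_c D (S (u i a)) (u a m * S (u c j)) (m == c)%:R).
  apply: eq_bigr => a _.
  rewrite -(antipode_corepr _ _ uP) (linear_sumf _ _ _ ((lD _).1 _)).
  apply: eq_bigr => m _; rewrite (sum_only (j := m)) ?eqxx // => c /negPf cm.
  by rewrite eq_sym cm; apply: linear0f ((lD _).2 _).
transitivity (\sum_a \sum_m \sum_c \sum_b
    D (S (u i a)) (u a m * S (u c j)) (u m b * S (u b c))).
  do 3!(apply: eq_bigr => ? _); rewrite -(antipode_corepr _ _ uP).
  exact: (linear_sumf _ _ _ ((lD _).2 _)).
transitivity (\sum_c \sum_b \sum_a D (S (u i a) * u a b) (S (u c j)) (S (u b c))).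
  under [RHS]eq_bigr => c _ do under eq_bigr => b _ do
    under eq_bigr => a _ do rewrite DM.
  rewrite [RHS](eq_bigr (fun c => \sum_a \sum_b \sum_m
    D (S (u i a)) (u a m * S (u c j)) (u m b * S (u b c)))); last first.
    by move=> c _; rewrite exchange_big.
  rewrite [RHS]exchange_big; apply: eq_bigr => a _ /=.
  rewrite exchange_big; apply: eq_bigr => c _ /=.
  by rewrite exchange_big.
apply: eq_bigr => c _.
under eq_bigr => b _ do rewrite -(linear_sumf _ _ _ (lD1 _ _)) antipode_corepl //.
rewrite (sum_only (j := i)) => [|b /negPf bi]; last first.
  by rewrite eq_sym bi; apply: linear0f (lD1 _ _).
by rewrite eqxx /D sw1 ?mul1r //; lin.
Qed.

(** Thus $x \mapsto S(x^\circ)$ is an involution. Applying this map to $\sum_k u_{jk} S(u_{ki}) =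
    \delta_{ij}$ yields a left inverse of the matrix $S(u)$, whose right inverse is [u]. *)
Lemma antipode_circK x : S (circ X (S (circ X x))) = x.
Proof.
apply: (ucorep_ext (f := fun x => S (circ X (S (circ X x)))) (g := idfun)) => {x}.
- by move=> a x y; rewrite circP linearP circP linearP conjCK.
- by [].
move=> n u [uP uU] i j; rewrite uU /=.
apply: (@left_right_inverse H _ (fun i j => S (circ X (S (u j i))))
  (fun i j => S (u i j)) u) => {i j} i j; last exact: antipode_corepl.
have := antipode_corepr j i uP => /(congr1 (fun x => S (circ X x))).
rewrite -natrA circ_alg linearZ /= antipode1 conjC_nat natrA eq_sym => <-.
rewrite circ_sum linear_sum; apply: eq_bigr => k _.
by rewrite circM uU antipodeM.
Qed.

(** * Invariance properties of the Haar functional *)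

Definition haar (psi : {scalar H}) : Prop :=
  [/\ psi 1 = 1,
      forall x, sw x (fun a b => psi b *: a) = (psi x)%:A,
      forall x, sw x (fun a b => psi a *: b) = (psi x)%:A
    & forall x, psi (circ X x) = (psi x)^*].

Variable psi : {scalar H}.
Hypothesis psiP : haar psi.

Lemma haar_corepl m n (u : 'I_m -> 'I_m -> H) (v : 'I_n -> 'I_n -> H) i j k l :
  corep X u -> corep X v -> 
  (psi (u i j * v k l))%:A =
  \sum_p \sum_q psi (u i p * v k q) *: (u p j * v q l).
Proof.
move=> uP vP; have [_ _ + _] := psiP => <-.
by rewrite sw_corepM //; lin.
Qed.

Lemma haar_corepr m n (u : 'I_m -> 'I_m -> H) (v : 'I_n -> 'I_n -> H) i j k l :
  corep X u -> corep X v -> 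
  (psi (u i j * v k l))%:A =
  \sum_p \sum_q psi (u p j * v q l) *: (u i p * v k q).
Proof.
move=> uP vP; have [_ + _ _] := psiP => <-.
by rewrite sw_corepM //; lin.
Qed.

(** The contragredient: the antipode reverses the legs and the transposition of indices restores
    their order. *)
Lemma corep_dual n (u : 'I_n -> 'I_n -> H) : corep X u ->
  corep X (fun i j => S (u j i)).
Proof.
move=> uP; split=> [i j W f fb|i j].
  by rewrite sw_antipode // uP.1 //; lin.
have := antipode_corepl j i uP => /(congr1 eps).
rewrite linear_sum /=; under eq_bigr => k _ do rewrite counitM uP.2.
by rewrite sum_delta_mulr -natrA linearZ /= counit1 mulr1 eq_sym.
Qed.

(** Strong invariance: apply invariance to $x S(y_1)$, multiply by $y_2$ on the right, and collapse
    $S(y_2) y_3$. The next two lemmas vary this. *)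
Lemma haar_translater x y :
  sw x (fun a b => psi (b * S y) *: a) = sw y (fun a b => psi (x * S a) *: b).
Proof.
apply: (ucorep_ext (f := fun x => sw x (fun a b => psi (b * S y) *: a))
  (g := fun x => sw y (fun a b => psi (x * S a) *: b))) => {x};
  [by lin | by lin | move=> m u [uP _] i j].
apply: (ucorep_ext (f := fun y => sw (u i j) (fun a b => psi (b * S y) *: a))
  (g := fun y => sw y (fun a b => psi (u i j * S a) *: b))) => {y};
  [by lin | by lin | move=> n v [vP _] k l].
rewrite uP.1; last by lin.
rewrite vP.1; last by lin.
transitivity (\sum_r \sum_p \sum_q
    psi (u p j * S (v k q)) *: (u i p * (S (v q r) * v r l))).
  rewrite exchange_big; apply: eq_bigr => p _ /=; rewrite exchange_big /=.
  rewrite (sum_only (j := l)) => [|q /negPf ql]; rewrite -scaler_sumr -mulr_sumr;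
    rewrite antipode_corepl //; last by rewrite ql mulr0 scaler0.
  by rewrite eqxx mulr1.
apply: eq_bigr => r _.
rewrite -[v r l in RHS]mul1r scalerAl (haar_corepr i j r k uP (corep_dual vP)).
rewrite mulr_suml; apply: eq_bigr => p _; rewrite mulr_suml.
by apply: eq_bigr => q _; rewrite -scalerAl mulrA.
Qed.

Lemma haar_translatel x w :
  sw x (fun a b => psi (S w * a) *: b) = sw w (fun a b => psi (S b * x) *: a).
Proof.
apply: (ucorep_ext (f := fun x => sw x (fun a b => psi (S w * a) *: b))
  (g := fun x => sw w (fun a b => psi (S b * x) *: a))) => {x};
  [by lin | by lin | move=> m u [uP _] i j].
apply: (ucorep_ext (f := fun w => sw (u i j) (fun a b => psi (S w * a) *: b))
  (g := fun w => sw w (fun a b => psi (S b * u i j) *: a))) => {w};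
  [by lin | by lin | move=> n v [vP _] k l].
rewrite uP.1; last by lin.
rewrite vP.1; last by lin.
transitivity (\sum_r \sum_q \sum_p
    psi (S (v q l) * u i p) *: (v k r * S (v r q) * u p j)).
  rewrite exchange_big /= (sum_only (j := k)) => [|q /negPf qk]; last first.
    rewrite exchange_big big1 //= => p _.
    by rewrite -scaler_sumr -mulr_suml antipode_corepr // eq_sym qk mul0r scaler0.
  rewrite exchange_big; apply: eq_bigr => p _.
  by rewrite -scaler_sumr -mulr_suml antipode_corepr // eqxx mul1r.
apply: eq_bigr => r _.
rewrite -[v k r in RHS]mulr1 scalerAr (haar_corepl l r i j (corep_dual vP) uP).
rewrite mulr_sumr; apply: eq_bigr => q _; rewrite mulr_sumr.
by apply: eq_bigr => p _; rewrite -scalerAr mulrA.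
Qed.

Lemma haar_translate y w :
  sw y (fun a b => psi (a * w) *: b) = sw w (fun a b => psi (y * a) *: S b).
Proof.
apply: (ucorep_ext (f := fun y => sw y (fun a b => psi (a * w) *: b))
  (g := fun y => sw w (fun a b => psi (y * a) *: S b))) => {y};
  [by lin | by lin | move=> m u [uP _] i j].
apply: (ucorep_ext (f := fun w => sw (u i j) (fun a b => psi (a * w) *: b))
  (g := fun w => sw w (fun a b => psi (u i j * a) *: S b))) => {w};
  [by lin | by lin | move=> n v [vP _] k l].
rewrite uP.1; last by lin.
rewrite vP.1; last by lin.
transitivity (\sum_r \sum_p \sum_q
    psi (u i p * v k q) *: (u p j * (v q r * S (v r l)))).
  rewrite exchange_big; apply: eq_bigr => p _ /=; rewrite exchange_big /=.
  rewrite (sum_only (j := l)) => [|q /negPf ql]; rewrite -scaler_sumr -mulr_sumr;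
    rewrite antipode_corepr //; last by rewrite ql mulr0 scaler0.
  by rewrite eqxx mulr1.
apply: eq_bigr => r _.
rewrite -[S (v r l) in RHS]mul1r scalerAl (haar_corepl i j k r uP vP).
rewrite mulr_suml; apply: eq_bigr => p _; rewrite mulr_suml.
by apply: eq_bigr => q _; rewrite -scalerAl mulrA.
Qed.

(** Both sides equal $\sum \psi(S(y_1)) \psi(y_2)$: for one apply [psi] to strong invariance at $x =
    1$, for the other apply $\psi S$ to the invariance of [psi]. *)
Lemma haar_antipode y : psi (S y) = psi y.
Proof.
have [psi1 psil psir _] := psiP.
have := haar_translater 1 y; rewrite sw1; last by lin.
under [RHS]eq_sw => a b do rewrite mul1r.
rewrite mul1r => /(congr1 psi); rewrite linearZ /= psi1 mulr1 => ->.
rewrite (@sw_linear _ _ X _ C^o psi); last exact: lin_scalar.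
have := congr1 (fun z => psi (S z)) (psil y).
rewrite (@sw_linear _ _ X _ C^o (fun z => psi (S z))); last first.
  by apply: lin_comp; [exact: lin_scalar | lin].
rewrite !linearZ /= antipode1 psi1 mulr1 => <-.
by apply: eq_sw => a b; rewrite !linearZ /= mulrC.
Qed.

Definition haar_form x y := psi (x * S (circ X y)).

Lemma haar_form_linear y : linear (haar_form ^~ y : H -> C^o).
Proof.
by move=> a x z; rewrite /haar_form mulrDl -scalerAl linearP.
Qed.

(** The conjugate of $\psi(z)$ is $\psi(S(z^\circ))$, and $z \mapsto S(z^\circ)$ is an
    antimultiplicative involution. *)
Lemma haar_form_sym x y : haar_form y x = (haar_form x y)^*.
Proof.
have [_ _ _ psic] := psiP.
by rewrite /haar_form -psic circM -[RHS]haar_antipode antipodeM antipode_circK.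
Qed.

Lemma haar_form_hermitian : hermitian_form haar_form.
Proof. by split; [exact: haar_form_linear | exact: haar_form_sym]. Qed.

Lemma integral_form_sym x y :
  integral_form X psi y x = (integral_form X psi x y)^*.
Proof.
have [_ _ _ psic] := psiP.
by rewrite /integral_form -psic circM -[RHS]haar_antipode antipodeM antipode_circK.
Qed.

End Antipode.

(** * Existence of the Haar functional, orthogonality relations *)

Lemma delta_row_neq0 (K : nzRingType) n (i : 'I_n) :
  delta_mx 0 i != 0 :> 'rV[K]_n.
Proof.
apply/eqP => /rowP /(_ i); rewrite !mxE !eqxx => /eqP.
by rewrite oner_eq0.
Qed.

Section Haar.
Variable R : realType.
Local Notation C := R[i].
Variables (H : algType C) (X : circ_hopf_algebra H).
Local Notation sw := (sw X).
Local Notation eps := (counit X).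
Local Notation S := (antipode X).

Lemma sw_circ (W : lmodType C) (f : H -> H -> W) x : bilin f ->
  sw (circ X x) f = sw x (fun a b => f (circ X b) (circ X a)).
Proof.
move=> fb; have /tensor_eq_bilin E := circ_comul (circ X) x.
by rewrite /sw E // big_map.
Qed.

Lemma circ_sw x (f : H -> H -> H) :
  circ X (sw x f) = sw x (fun a b => circ X (f a b)).
Proof. exact: circ_sum. Qed.

Lemma scalar_of (V : lmodType C) (f : V -> C) : linear (f : V -> C^o) ->
  exists g : {scalar V}, forall x, g x = f x.
Proof.
move=> lf; pose lf' : GRing.linear_for *%R f := lf.
by exists (HB.pack_for {scalar V} f (GRing.isLinear.Build C V C *%R f lf')).
Qed.

Variable ip : H -> H -> C.
Hypotheses (ipP : inner_product ip) (ipU : unitary_form X ip).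

Lemma haar_exists : exists psi : {scalar H}, haar X psi.
Proof.
have ipl := ip_linear ipP.
have ip1 : ip 1 1 != 0.
  by rewrite gt_eqF // (ip_gt0 ipP) ?oner_neq0.
have [psi psiE] : exists psi : {scalar H}, forall x, psi x = (ip 1 1)^-1 * ip x 1.
  apply: scalar_of => a x y.
  by rewrite (ipl 1) mulrDr; congr (_ + _); rewrite /= mulrCA.
have psi1 : psi 1 = 1 by rewrite psiE mulVf.
(* Unitarity moves the comultiplication from [x] to [1], where it is trivial. *)
have psir x : sw x (fun a b => psi a *: b) = (psi x)%:A.
  under eq_sw => a b do rewrite psiE -scalerA.
  rewrite /sw -scaler_sumr -/(sw x (fun a b => ip a 1 *: b)) ipU.
  rewrite -[LHS](circK X) circZ circ_sw.
  under eq_sw => a b do rewrite circZ circK -(ip_sym ipP).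
  rewrite sw1; last by lin.
  rewrite (circZ X _ (_ *: 1)) (circ_alg X) conjCK -(ip_sym ipP).
  by rewrite scalerA psiE.
have [psi' psi'E] : exists psi' : {scalar H}, forall x, psi' x = (psi (circ X x))^*.
  apply: scalar_of => a x y.
  by rewrite circP linearP rmorphD rmorphM /= conjCK.
have psil x : sw x (fun a b => psi' b *: a) = (psi' x)%:A.
  rewrite psi'E -(circ_alg X) -psir sw_circ; last by lin.
  by rewrite circ_sw; apply: eq_sw => a b; rewrite circZ circK psi'E.
(* Each functional, applied to the invariance identity of the other, gives the same scalar $\sum
   \psi(x_1) \psi'(x_2)$. *)
have psiE' x : psi' x = psi x.
  have l1 := psil x; have := psir x => /(congr1 psi').
  rewrite linearZ /= (psi'E 1) circ1 psi1 conjC1 mulr1 => <-.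
  have := l1 => /(congr1 psi); rewrite linearZ /= psi1 mulr1 => <-.
  rewrite (@sw_linear _ _ X _ C^o psi); last exact: lin_scalar.
  rewrite (@sw_linear _ _ X _ C^o psi'); last exact: lin_scalar.
  by apply: eq_sw => a b; rewrite !linearZ /= mulrC.
exists psi; split=> // x.
  by under eq_sw => a b do rewrite -psiE'; rewrite psil psiE'.
by rewrite -[in RHS]psiE' psi'E conjCK.
Qed.

End Haar.

(** * Unitary forms on the regular comodule and on matrix comodules *)

Section DualForm.
Variable R : realType.
Local Notation C := R[i].
Variables (H : algType C) (X : circ_hopf_algebra H).
Local Notation sw := (sw X).
Local Notation eps := (counit X).
Hypothesis cqgX : compact_quantum_group X.

Lemma regular_form : exists2 ip : H -> H -> C,
  inner_product ip & unitary_form X ip.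
Proof.
pose rho := @RightComodule _ _ X H (comul X) (@comul_linear _ _ X) (@comulA _ _ X)
  (@counitr _ _ X).
by have [ip ipU] := cqgX rho; exists ip => //; exact: dot_inner_product.
Qed.

Variables (n : nat) (w : 'I_n -> 'I_n -> H).
Hypothesis wP : corep X w.

(* The coaction [e_j |-> \sum_i e_i (x) w_ij]. *)
Definition row_coact (v : 'rV[C]_n) : seq ('rV[C]_n * H) :=
  [seq (delta_mx 0 i, \sum_j v 0 j *: w i j) | i <- enum 'I_n].

Lemma row_coactE (W : lmodType C) (f : 'rV[C]_n -> H -> W) v :
  \sum_(p <- row_coact v) f p.1 p.2 =
  \sum_i f (delta_mx 0 i) (\sum_j v 0 j *: w i j).
Proof. by rewrite /row_coact big_map big_enum. Qed.

Lemma row_coact_linear : tensor_linear row_coact.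
Proof.
move=> a x y; apply/tensor_eq_bilin => W f fb.
rewrite big_cat [X in _ = X + _]big_map !row_coactE /=.
rewrite [X in _ = X + _](row_coactE (fun p q => f (a *: p) q)) -big_split.
apply: eq_bigr => i _ /=; rewrite (linearZf _ _ (fb.1 _)) -(linearZf _ _ (fb.2 _)).
rewrite -(linearDf _ _ (fb.2 _)); congr (f _ _).
rewrite scaler_sumr -big_split; apply: eq_bigr => j _.
by rewrite !mxE scalerDl scalerA.
Qed.

Lemma row_coactA v :
  tensor3_eq [seq (q.1, q.2, p.2) | p <- row_coact v, q <- row_coact p.1]
             [seq (p.1, q.1, q.2) | p <- row_coact v, q <- comul X p.2].
Proof.
move=> W f [f1 f2 f3]; rewrite !big_allpairs_dep.
rewrite [LHS](row_coactE (fun a b => \sum_(q <- row_coact a) f q.1 q.2 b)).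
rewrite [RHS](row_coactE (fun a b => \sum_(q <- comul X b) f a q.1 q.2)).
transitivity (\sum_i \sum_k f (delta_mx 0 k)
    (\sum_j (delta_mx 0 i : 'rV[C]_n) 0 j *: w k j) (\sum_j v 0 j *: w i j)).
  by apply: eq_bigr => i _; rewrite [LHS](row_coactE (fun c d => f c d _)).
rewrite exchange_big; apply: eq_bigr => i _ /=.
rewrite [RHS](linear_sumf _ _ _ (lin_sw X (f := f (delta_mx 0 i)) _)); last by lin.
under [RHS]eq_bigr => j _.
  rewrite (linearZf _ _ (lin_sw X (f := f (delta_mx 0 i)) _)); last by lin.
  rewrite wP.1; last by lin.
  rewrite scaler_sumr.
over.
rewrite [RHS]exchange_big; apply: eq_bigr => k _ /=.
rewrite (linear_sumf _ _ _ (f3 _ _)); apply: eq_bigr => j _.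
rewrite (linearZf _ _ (f3 _ _)); congr (_ *: f _ _ _).
rewrite (sum_only (j := k)) => [|l /negPf lk]; rewrite mxE /=.
  by rewrite eqxx scale1r.
by rewrite lk scale0r.
Qed.

Lemma row_coact_counit v : \sum_(p <- row_coact v) eps p.2 *: p.1 = v.
Proof.
rewrite [LHS](row_coactE (fun a b => eps b *: a)) [RHS]row_sum_delta.
apply: eq_bigr => i _; congr (_ *: _); rewrite linear_sum /=.
rewrite (sum_only (j := i)) => [|l /negPf li]; rewrite linearZ /= wP.2.
  by rewrite eqxx mulr1.
by rewrite eq_sym li mulr0.
Qed.

(** Here [w] is any corepresentation; the case used later is the contragredient of an irreducible
    one, whose form yields a positive definite Gram matrix. *)
Lemma unitary_row_form : exists2 ip : 'rV[C]_n -> 'rV[C]_n -> C,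
  inner_product ip & forall j l,
    \sum_i ip (delta_mx 0 i) (delta_mx 0 l) *: w i j =
    \sum_i ip (delta_mx 0 j) (delta_mx 0 i) *: circ X (w i l).
Proof.
have [ip ipU] := cqgX (RightComodule row_coact_linear row_coactA row_coact_counit).
exists ip => [|j l]; first exact: dot_inner_product.
have colE i k : \sum_q (delta_mx 0 k : 'rV[C]_n) 0 q *: w i q = w i k.
  rewrite (sum_only (j := k)) => [|q /negPf qk]; rewrite mxE /=.
    by rewrite eqxx scale1r.
  by rewrite qk scale0r.
apply: etrans (etrans _ (ipU (delta_mx 0 j) (delta_mx 0 l))) _.
  rewrite [RHS](row_coactE (fun a b => ip a (delta_mx 0 l) *: b)).
  by under [RHS]eq_bigr do rewrite colE.
rewrite [LHS](row_coactE (fun a b => ip (delta_mx 0 j) a *: circ X b)).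
by under eq_bigr do rewrite colE.
Qed.

End DualForm.

(** * Schur orthogonality for irreducible corepresentations *)

Section Irreducible.
Variable R : realType.
Local Notation C := R[i].
Variables (H : algType C) (X : circ_hopf_algebra H).
Local Notation sw := (sw X).
Local Notation eps := (counit X).
Local Notation S := (antipode X).
Hypothesis cqgX : compact_quantum_group X.
Hypothesis spanU : forall x, exists n (u : 'I_n -> 'I_n -> H), ucorep X u /\
  exists c : 'I_n -> 'I_n -> C, x = \sum_i \sum_j c i j *: u i j.
Variable psi : {scalar H}.
Hypothesis psiP : haar X psi.

Definition intertwines n (u : 'I_n -> 'I_n -> H) (M : 'M[C]_n) : Prop :=
  forall i j, \sum_k M i k *: u k j = \sum_k M k j *: u i k.

(* Irreducibility in the form of Schur's lemma: the commutant is scalar. *)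
Definition irrep n (u : 'I_n -> 'I_n -> H) : Prop :=
  [/\ (0 < n)%N, ucorep X u
    & forall M, intertwines u M -> exists c, M = c%:M].

Section Orthogonality.
Variables (n : nat) (u : 'I_n -> 'I_n -> H).
Hypothesis uI : irrep u.
Let uP : corep X u. Proof. by case: uI => _ []. Qed.
Let uU i j : circ X (u i j) = u j i. Proof. by case: uI => _ []. Qed.

(** Schur's lemma produces the Kronecker factor; what remains is the Gram matrix of the dual form
    divided by its trace. *)
Lemma haar_orthogonality : exists ip : 'rV[C]_n -> 'rV[C]_n -> C,
  inner_product ip /\ exists2 t, 0 < t & forall i j k l,
    psi (u i j * S (u l k)) =
    (i == k)%:R * (t * ip (delta_mx 0 l) (delta_mx 0 j)).
Proof.
have [n_gt0 _ schur] := uI; pose i0 := Ordinal n_gt0.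
pose h j l := psi (u i0 j * S (u l i0)).
have hE i j k l : psi (u i j * S (u l k)) = (i == k)%:R * h j l.
  (* For fixed [j] and [l], [haar_translater] says exactly that this matrix intertwines [u]. *)
  pose M := \matrix_(i, k) psi (u i j * S (u l k)).
  have [a b|c Mc] := schur M.
    have := haar_translater spanU psiP (u a j) (u l b).
    rewrite uP.1; last by lin.
    rewrite uP.1; last by lin.
    move=> E; under eq_bigr do rewrite mxE; rewrite -E.
    by apply: eq_bigr => k' _; rewrite mxE.
  have /matrixP ME := Mc; have := ME i k; have := ME i0 i0.
  rewrite !mxE eqxx mulr1n -/(h j l) => -> ->.
  by rewrite mulr_natl.
have [ip ipP ipU] := unitary_row_form cqgX (corep_dual spanU uP).
pose G i j := ip (delta_mx 0 i) (delta_mx 0 j).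
pose t := \sum_i G i i.
have t_gt0 : 0 < t.
  rewrite /t (bigD1 i0) //= ltr_wpDr ?sumr_ge0 // => [i _|].
    by apply/ltW/(ip_gt0 ipP)/delta_row_neq0.
  exact/(ip_gt0 ipP)/delta_row_neq0.
exists ip; split=> //; exists t^-1; first by rewrite invr_gt0.
move=> i j k l; rewrite hE; congr (_ * _).
suff E : t * h j l = G l j by rewrite -/(G l j) -E mulKf // gt_eqF.
have uS p : \sum_q u q j * circ X (S (u q p)) = (j == p)%:R.
  transitivity (circ X (j == p)%:R).
    rewrite -(antipode_corepr _ _ uP) circ_sum.
    by apply: eq_bigr => q _; rewrite circM uU.
  by case: eqP => _; [exact: circ1 | exact: circ0].
(* Unitarity of the dual form followed by [uS]. Applying [psi], the left side becomes the trace [t]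
   times [h j l]. *)
have key : \sum_q \sum_p G p q *: (u q j * S (u l p)) = (G l j)%:A.
  transitivity (\sum_q \sum_p G l p *: (u q j * circ X (S (u q p)))).
    apply: eq_bigr => q _.
    rewrite (eq_bigr (fun p => u q j * (G p q *: S (u l p)))); last first.
      by move=> p _; rewrite scalerAr.
    rewrite -mulr_sumr ipU mulr_sumr.
    by apply: eq_bigr => p _; rewrite scalerAr.
  rewrite exchange_big /= (sum_only (j := j)) => [|p pj];
    rewrite -scaler_sumr uS; first by rewrite eqxx.
  by rewrite eq_sym (negPf pj) scaler0.
have [psi1 _ _ _] := psiP.
have := congr1 psi key; rewrite linearZ /= psi1 mulr1 => <-.
rewrite linear_sum mulr_suml; apply: eq_bigr => q _; rewrite linear_sum /=.
rewrite (sum_only (j := q)) => [|p /negPf pq]; rewrite linearZ /= hE.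
  by rewrite eqxx mul1r.
by rewrite eq_sym pq mul0r mulr0.
Qed.

Lemma irrep_form_gt0 (c : 'I_n -> 'I_n -> C) i0 j0 : c i0 j0 != 0 ->
  0 < haar_form X psi (\sum_i \sum_j c i j *: u i j)
        (\sum_i \sum_j c i j *: u i j).
Proof.
move=> c0; have [ip [ipP [t t_gt0 E]]] := haar_orthogonality.
(* The form decouples over the rows of [c]; the conjugates compensate for the exchanged indices [l],
   [j] in the Gram matrix. *)
pose w i : 'rV[C]_n := \sum_l (c i l)^* *: delta_mx 0 l.
have -> : haar_form X psi (\sum_i \sum_j c i j *: u i j)
    (\sum_i \sum_j c i j *: u i j) = t * \sum_i ip (w i) (w i).
  have rP := haar_form_hermitian spanU psiP.
  rewrite (ip_suml rP) mulr_sumr; apply: eq_bigr => i _.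
  rewrite (ip_sumr rP) (sum_only (j := i)) => [|k /negPf ki].
    rewrite (ip_sumr rP) [ip _ _](ip_suml ipP) mulr_sumr; apply: eq_bigr => l _.
    rewrite (ip_suml rP) (ip_sumr ipP) mulr_sumr; apply: eq_bigr => j _.
    rewrite (ipZl rP) (ipZr rP) (ipZl ipP) (ipZr ipP) conjCK.
    rewrite /haar_form uU E eqxx mul1r.
    by rewrite mulrCA [RHS]mulrCA [c i j * (t * _)]mulrCA.
  rewrite (ip_sumr rP) big1 // => l _; rewrite (ip_suml rP) big1 // => j _.
  by rewrite (ipZl rP) (ipZr rP) /haar_form uU E eq_sym ki mul0r !mulr0.
have w_ge0 i : 0 <= ip (w i) (w i).
  have [->|wi] := eqVneq (w i) 0; first by rewrite (linear0f (ip_linear ipP 0)).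
  exact/ltW/(ip_gt0 ipP).
rewrite mulr_gt0 // (bigD1 i0) //= ltr_wpDr ?sumr_ge0 //.
apply: (ip_gt0 ipP); apply: contraNneq c0 => /rowP /(_ j0).
rewrite summxE (sum_only (j := j0)) => [|l /negPf lj].
  by rewrite !mxE !eqxx mulr1 => /eqP; rewrite conjC_eq0.
by rewrite !mxE eq_sym lj mulr0.
Qed.

(** Riesz for the Gram form represents the [j]-th coordinate, so functionals $x \mapsto \psi(x
    S(z))$ can isolate a single entry of [u]. *)
Lemma irrep_dual k j : exists z, forall m l,
  psi (u m l * S z) = (m == k)%:R * (l == j)%:R.
Proof.
have [ip [ipP [t t_gt0 E]]] := haar_orthogonality.
have [|w wP] := riesz ipP (tau := fun v : 'rV[C]_n => v 0 j)
    [seq delta_mx 0 i | i <- enum 'I_n].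
  by move=> a x y; rewrite !mxE.
exists (t^-1 *: \sum_q w 0 q *: u q k) => m l.
rewrite linearZ linear_sum /= -scalerAr linearZ /= mulr_sumr linear_sum /=.
under eq_bigr => q _.
  rewrite linearZ /= -scalerAr linearZ /= E mulrCA [w 0 q * _]mulrCA.
over.
rewrite -mulr_sumr mulrCA -mulr_sumr (mulKf (lt0r_neq0 t_gt0)); congr (_ * _).
have := wP (delta_mx 0 l) (map_f _ (mem_enum _ l)); rewrite mxE eqxx /= eq_sym.
move=> /(congr1 Num.conj); rewrite conjC_nat => ->.
rewrite {2}[w]row_sum_delta (ip_sumr ipP) rmorph_sum; apply: eq_bigr => q _.
by rewrite (ipZr ipP) rmorphM /= conjCK -(ip_sym ipP).
Qed.

End Orthogonality.


End Irreducible.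

(** * Decomposition into irreducible corepresentations *)

Section Decomposition.
Variable R : realType.
Local Notation C := R[i].
Variables (H : algType C) (X : circ_hopf_algebra H).
Local Notation eps := (counit X).
Hypothesis spanU : forall x, exists n (u : 'I_n -> 'I_n -> H), ucorep X u /\
  exists c : 'I_n -> 'I_n -> C, x = \sum_i \sum_j c i j *: u i j.

(** * Unitary change of basis of a corepresentation *)

Section Conjugation.
Variables (n : nat) (u : 'I_n -> 'I_n -> H) (P Q : 'M[C]_n).
Hypotheses (uP : ucorep X u) (PQ : P *m Q = 1%:M) (QE : Q = map_mx Num.conj P^T).

Definition conj_corep i j := \sum_a \sum_b (P i a * Q b j) *: u a b.
Local Notation v := conj_corep.

Lemma conj_ucorep : ucorep X v.
Proof.
have [[uD ue] uU] := uP; have QP := mulmx1C PQ.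
split; first split=> [i j W f fb|i j].
- have lsw := lin_sw X fb.
  (* Inserting $QP = 1$ doubles the inner index, so that the factors of $v_{ik}$ and $v_{kj}$
     separate. *)
  transitivity (\sum_a \sum_b \sum_c \sum_d
      ((Q *m P) c d * (P i a * Q b j)) *: f (u a c) (u d b)).
    rewrite /v (linear_sumf _ _ _ lsw); apply: eq_bigr => a _.
    rewrite (linear_sumf _ _ _ lsw); apply: eq_bigr => b _.
    rewrite (linearZf _ _ lsw) uD // scaler_sumr; apply: eq_bigr => c _.
    rewrite (sum_only (j := c)) => [|d /negPf dc]; rewrite QP mxE.
      by rewrite eqxx mul1r.
    by rewrite eq_sym dc mul0r scale0r.
  transitivity (\sum_a \sum_b \sum_c \sum_d \sum_k
      ((P i a * Q c k) * (P k d * Q b j)) *: f (u a c) (u d b)).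
    do 4!(apply: eq_bigr => ? _).
    rewrite mxE mulr_suml scaler_suml; apply: eq_bigr => k _; congr (_ *: _).
    by rewrite !mulrA; congr (_ * _); rewrite mulrC !mulrA.
  have vE k : f (v i k) (v k j) = \sum_a \sum_c \sum_d \sum_b
      ((P i a * Q c k) * (P k d * Q b j)) *: f (u a c) (u d b).
    rewrite /v (linear_sumf _ _ _ (fb.1 _)); apply: eq_bigr => a _.
    rewrite (linear_sumf _ _ _ (fb.1 _)); apply: eq_bigr => c _.
    rewrite (linear_sumf _ _ _ (fb.2 _)); apply: eq_bigr => d _.
    rewrite (linear_sumf _ _ _ (fb.2 _)); apply: eq_bigr => b _.
    by rewrite (linearZf _ _ (fb.1 _)) (linearZf _ _ (fb.2 _)) scalerA.
  under [RHS]eq_bigr => k _ do rewrite vE.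
  rewrite [RHS]exchange_big; apply: eq_bigr => a _ /=.
  rewrite exchange_big [RHS]exchange_big; apply: eq_bigr => c _ /=.
  rewrite exchange_big [RHS]exchange_big; apply: eq_bigr => d _ /=.
  by rewrite [RHS]exchange_big.
- rewrite /v linear_sum /=.
  transitivity (\sum_a P i a * Q a j).
    apply: eq_bigr => a _.
    rewrite linear_sum /= (sum_only (j := a)) => [|b /negPf ba].
      by rewrite linearZ /= ue eqxx mulr1.
    by rewrite linearZ /= ue eq_sym ba mulr0.
  by have /matrixP/(_ i j) := PQ; rewrite !mxE.
- move=> i j; rewrite /v circ_sum exchange_big; apply: eq_bigr => a _.
  rewrite circ_sum; apply: eq_bigr => b _.
  rewrite circZ uU rmorphM /= QE !mxE conjCK mulrC.
  by [].
Qed.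

Lemma conj_corepK i j : u i j = \sum_a \sum_b (Q i a * P b j) *: v a b.
Proof.
have QP := mulmx1C PQ.
transitivity (\sum_c \sum_d ((Q *m P) i c * (Q *m P) d j) *: u c d).
  rewrite (sum_only (j := i)) => [|c /negPf ci]; last first.
    by rewrite big1 // => d _; rewrite QP mxE eq_sym ci mul0r scale0r.
  rewrite (sum_only (j := j)) => [|d /negPf dj]; last first.
    by rewrite QP [in X in _ * X]mxE dj mulr0 scale0r.
  by rewrite QP !mxE !eqxx mulr1 scale1r.
under [RHS]eq_bigr => a _ do under eq_bigr => b _ do rewrite /v scaler_sumr.
rewrite [RHS](eq_bigr (fun a => \sum_c \sum_b \sum_d
  ((Q i a * P a c) * (Q d b * P b j)) *: u c d)) => [|a _]; last first.
  rewrite exchange_big; apply: eq_bigr => c _; apply: eq_bigr => b _ /=.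
  rewrite scaler_sumr; apply: eq_bigr => d _; rewrite scalerA; congr (_ *: _).
  by rewrite -!mulrA; congr (_ * _); rewrite mulrCA; congr (_ * _); rewrite mulrC.
rewrite [RHS]exchange_big; apply: eq_bigr => c _ /=.
rewrite (eq_bigr (fun d => \sum_a \sum_b
  ((Q i a * P a c) * (Q d b * P b j)) *: u c d)) => [|d _]; last first.
  rewrite mxE mulr_suml scaler_suml; apply: eq_bigr => a _.
  by rewrite mxE mulr_sumr scaler_suml.
rewrite exchange_big; apply: eq_bigr => a _ /=.
by rewrite exchange_big.
Qed.

(** When [P] diagonalizes [M], the new matrix commutes with the diagonal one, so its entries between
    distinct eigenvalues vanish. *)
Lemma conj_intertwines (M : 'M[C]_n) (d : 'rV[C]_n) : intertwines u M ->
  P *m M = diag_mx d *m P -> forall i j, d 0 i *: v i j = d 0 j *: v i j.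
Proof.
move=> uM PM i j.
have MQ : M *m Q = Q *m diag_mx d.
  by rewrite -[M]mul1mx -(mulmx1C PQ) -!mulmxA [P *m (M *m Q)]mulmxA PM
    -mulmxA PQ mulmx1.
have dP a : \sum_k P i k * M k a = d 0 i * P i a.
  by have /matrixP/(_ i a) := PM; rewrite mul_diag_mx !mxE.
have dQ b : \sum_k M b k * Q k j = Q b j * d 0 j.
  by have /matrixP/(_ b j) := MQ; rewrite mul_mx_diag !mxE.
transitivity (\sum_b \sum_k (P i k * Q b j) *: \sum_a M k a *: u a b).
  rewrite /v exchange_big scaler_sumr; apply: eq_bigr => b _ /=.
  under [RHS]eq_bigr => k _ do rewrite scaler_sumr.
  rewrite [RHS]exchange_big scaler_sumr; apply: eq_bigr => a _ /=.
  rewrite scalerA mulrA -dP mulr_suml scaler_suml; apply: eq_bigr => k _.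
  by rewrite scalerA mulrAC.
rewrite exchange_big scaler_sumr; apply: eq_bigr => k _ /=.
under eq_bigr => b _ do rewrite uM scaler_sumr.
rewrite exchange_big scaler_sumr; apply: eq_bigr => a _ /=.
rewrite scalerA mulrCA [d 0 j * _]mulrC -dQ mulr_sumr scaler_suml.
by apply: eq_bigr => b _; rewrite scalerA -mulrA [Q b j * _]mulrC.
Qed.

End Conjugation.
Lemma block_ucorep n (v : 'I_n -> 'I_n -> H) (J : {set 'I_n}) :
  ucorep X v -> (forall i k, i \in J -> k \notin J -> v i k = 0) ->
  ucorep X (fun a b : 'I_#|J| => v (enum_val a) (enum_val b)).
Proof.
move=> [[vD ve] vU] v0; split; first split=> [a b W f fb|a b].
- rewrite vD // (bigID [in J]) /= [X in _ + X]big1 ?addr0 => [|k kJ].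
    by rewrite big_enum_val.
  by rewrite v0 ?enum_valP //; apply: linear0f (fb.1 _).
- by rewrite ve (inj_eq enum_val_inj).
- by move=> a b; rewrite vU.
Qed.

Lemma intertwines_adjoint n (u : 'I_n -> 'I_n -> H) M : ucorep X u ->
  intertwines u M -> intertwines u (map_mx Num.conj M^T).
Proof.
move=> [_ uU] uM i j.
have E a b (c : 'I_n -> C) :
    circ X (\sum_k c k *: u (a k) (b k)) = \sum_k (c k)^* *: u (b k) (a k).
  by rewrite circ_sum; apply: eq_bigr => k _; rewrite (circZ X) uU.
have := congr1 (circ X) (uM j i).
rewrite [LHS](E id (fun=> i)) [RHS](E (fun=> j) id) => uM'.
under eq_bigr do rewrite !mxE; under [RHS]eq_bigr do rewrite !mxE.
exact: esym.
Qed.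

Lemma intertwinesD n (u : 'I_n -> 'I_n -> H) M M' :
  intertwines u M -> intertwines u M' -> intertwines u (M + M').
Proof.
move=> uM uM' i j.
under eq_bigr => k _ do rewrite mxE scalerDl.
under [RHS]eq_bigr => k _ do rewrite mxE scalerDl.
by rewrite !big_split /= uM uM'.
Qed.

Lemma intertwinesZ n (u : 'I_n -> 'I_n -> H) c M :
  intertwines u M -> intertwines u (c *: M).
Proof.
move=> uM i j.
under eq_bigr => k _ do rewrite mxE -scalerA.
under [RHS]eq_bigr => k _ do rewrite mxE -scalerA.
by rewrite -!scaler_sumr uM.
Qed.

(** The commutant is stable under adjoints, and [M] would be scalar if both $M + M^\dagger$ and $i(M
    - M^\dagger)$ were. *)
Lemma hermitian_intertwiner n (u : 'I_n -> 'I_n -> H) M : ucorep X u ->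
  intertwines u M -> (forall c, M <> c%:M) ->
  exists E, [/\ intertwines u E, map_mx Num.conj E^T = E
    & forall c, E <> c%:M].
Proof.
move=> uP uM Mc; pose Ms := map_mx Num.conj M^T.
have uMs : intertwines u Ms by exact: intertwines_adjoint.
have MsK : map_mx Num.conj Ms^T = M.
  by apply/matrixP => i j; rewrite !mxE conjCK.
have conjD (A B : 'M[C]_n) :
    map_mx Num.conj (A + B)^T = map_mx Num.conj A^T + map_mx Num.conj B^T.
  by apply/matrixP => i j; rewrite !mxE rmorphD.
have conjZ c (A : 'M[C]_n) :
    map_mx Num.conj (c *: A)^T = c^* *: map_mx Num.conj A^T.
  by apply/matrixP => i j; rewrite !mxE rmorphM.
have [[a Ea]|Ea] := pselect (exists c, M + Ms = c%:M); last first.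
  exists (M + Ms); split=> [||c E]; last by apply: Ea; exists c.
    exact: intertwinesD.
  by rewrite conjD MsK addrC.
exists ('i *: (M + (- 1) *: Ms)); split=> [||c].
- by apply: intertwinesZ; apply: intertwinesD => //; apply: intertwinesZ.
- rewrite conjZ conjD conjZ MsK conjCi rmorphN1 !scaleN1r.
  by rewrite scaleNr -scalerN opprB.
move=> /(congr1 (fun A => (- 'i) *: A)); rewrite scalerA mulNr -expr2 sqrCi opprK.
rewrite scale1r => E; apply: (Mc (2^-1 * (a + - 'i * c))).
have : M + Ms + (M + -1 *: Ms) = (a + - 'i * c)%:M.
  by rewrite Ea E scale_scalar_mx -raddfD.
rewrite addrACA scaleN1r subrr addr0 -mulr2n -scaler_nat => E2.
by rewrite -scale_scalar_mx -E2 scalerA mulVf ?scale1r // pnatr_eq0.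
Qed.

(** Strong induction on the size: a non-scalar hermitian intertwiner is diagonalized by a unitary,
    and its eigenspaces cut the corepresentation into smaller unitary blocks. *)
Lemma irrep_ind (P : H -> Prop) : subspace P ->
  (forall n (u : 'I_n -> 'I_n -> H), irrep X u -> forall i j, P (u i j)) ->
  forall x, P x.
Proof.
move=> sP Pirr x; have [n [u [uP [c ->]]]] := spanU x.
apply: subspace_sum => // i _; apply: subspace_sum => // j _.
apply: subspaceZ => //; move: {x c} n u uP i j; elim/ltn_ind => n IH u uP i0 j0.
have [irr|] := pselect (forall M, intertwines u M -> exists c, M = c%:M).
  by apply: Pirr; split=> //; apply: leq_ltn_trans (ltn_ord i0).
move=> /existsNP[M /not_implyP[uM Mc]].
have [c Mc'|E [uE EH Ec]] := hermitian_intertwiner uP uM.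
  by apply: Mc; exists c.
have : E \is normalmx by apply/normalmxP; rewrite EH.
move=> /orthomx_spectralP; set Q := spectralmx E; set d := spectral_diag E => ED.
have Qu : Q \is unitarymx by exact: spectral_unitarymx.
have QQ := unitarymxP Qu.
have QE : Q *m E = diag_mx d *m Q.
  by rewrite {1}ED -mulmxA mulKVmx // unitarymx_unit.
have vd := conj_intertwines QQ uE QE.
have vP := conj_ucorep uP QQ erefl.
set v := conj_corep u _ _ in vd vP.
suff Pv i j : P (v i j).
  rewrite (conj_corepK u QQ); do 2!(apply: subspace_sum => // ? _).
  exact: subspaceZ.
(* The eigenvalue block of [i]; entries of [v] from [J] to its complement vanish. *)
pose J := [set k | d 0 k == d 0 i]%SET.
have v0 a b : a \in J -> b \notin J -> v a b = 0.
  rewrite inE => /eqP da bJ; have /eqP := vd a b.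
  have db : d 0 b != d 0 i by move: bJ; rewrite inE.
  rewrite -subr_eq0 -scalerBl scaler_eq0 subr_eq0 da eq_sym (negPf db) /=.
  by move/eqP.
have iJ : i \in J by rewrite inE.
have [jJ|jJ] := boolP (j \in J); last by rewrite v0 //; case: sP.
have vJ := block_ucorep vP v0.
rewrite -(enum_rankK_in iJ iJ) -(enum_rankK_in iJ jJ).
apply: (IH _ _ _ vJ); rewrite -[X in (_ < X)%N]card_ord; apply: proper_card.
apply/properP; split; first by apply/fintype.subsetP.
(* The block is proper, since equal eigenvalues throughout would make [E] scalar. *)
have [[k dk]|dc] := pselect (exists k, d 0 k != d 0 i).
  by exists k => //; rewrite inE.
case: (Ec (d 0 i)); rewrite ED (_ : diag_mx d = (d 0 i)%:M).
  by rewrite -mulmxA mul_scalar_mx -scalemxAr mulVmx ?unitarymx_unit // scalemx1.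
apply/matrixP => a b; rewrite !mxE; congr (_ *+ _).
by apply/eqP; apply: contra_notT dc => da; exists a.
Qed.

End Decomposition.

(** * Simple components and the Nakayama automorphism *)

Section Components.
Variable R : realType.
Local Notation C := R[i].
Variables (H : algType C) (X : circ_hopf_algebra H).
Local Notation sw := (sw X).
Local Notation eps := (counit X).
Local Notation S := (antipode X).
Hypothesis cqgX : compact_quantum_group X.
Hypothesis spanU : forall x, exists n (u : 'I_n -> 'I_n -> H), ucorep X u /\
  exists c : 'I_n -> 'I_n -> C, x = \sum_i \sum_j c i j *: u i j.
Variable psi : {scalar H}.
Hypothesis psiP : haar X psi.

Definition coefs n (u : 'I_n -> 'I_n -> H) : set H :=
  [set x | exists c : 'I_n -> 'I_n -> C, x = \sum_i \sum_j c i j *: u i j].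

Lemma coefs_sum n (u : 'I_n -> 'I_n -> H) (P : H -> Prop) : subspace P ->
  (forall i j, P (u i j)) -> coefs u `<=` P.
Proof.
move=> sP Pu _ [c ->]; do 2!(apply: subspace_sum => // ? _).
exact: subspaceZ.
Qed.

Lemma coefs_subspace n (u : 'I_n -> 'I_n -> H) : subspace (coefs u).
Proof.
split=> [|a x y [c ->] [d ->]].
  exists (fun _ _ => 0); rewrite big1 // => i _; rewrite big1 // => j _.
  by rewrite scale0r.
exists (fun i j => a * c i j + d i j).
rewrite scaler_sumr -big_split; apply: eq_bigr => i _ /=.
rewrite scaler_sumr -big_split; apply: eq_bigr => j _ /=.
by rewrite scalerA scalerDl.
Qed.

Lemma coefs_mem n (u : 'I_n -> 'I_n -> H) i j : coefs u (u i j).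
Proof.
exists (fun k l => (k == i)%:R * (l == j)%:R).
rewrite (sum_only (j := i)) => [|k /negPf ki]; last first.
  by rewrite big1 // => l _; rewrite ki mul0r scale0r.
rewrite (sum_only (j := j)) => [|l /negPf lj].
  by rewrite !eqxx mul1r scale1r.
by rewrite lj mulr0 scale0r.
Qed.

Lemma submodP (A : set H) : submod_closed [in A] <-> subspace A.
Proof.
split=> [[A0 AD]|[A0 AD]]; split.
- by move: A0; rewrite inE.
- by move=> a x y Ax Ay; have := AD a x y; rewrite !inE; apply.
- by rewrite inE.
- by move=> a x y; rewrite !inE; apply: AD.
Qed.

Lemma coefs_subcoalgebra n (u : 'I_n -> 'I_n -> H) : corep X u ->
  subcoalgebra X (coefs u).
Proof.
move=> uP; split; first by apply/submodP; exact: coefs_subspace.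
move=> _ [c ->].
exists [seq (c p.1.1 p.1.2 *: u p.1.1 p.2, u p.2 p.1.2)
       | p <- enum {: 'I_n * 'I_n * 'I_n}].
  apply/tensor_eq_bilin => W f fb; rewrite big_map big_enum /=.
  rewrite -(pair_bigA _ (fun p k => f (c p.1 p.2 *: u p.1 k) (u k p.2))) /=.
  rewrite -(pair_bigA _ (fun i j => \sum_k f (c i j *: u i k) (u k j))) /=.
  have lsw := lin_sw X fb.
  rewrite [LHS](linear_sumf _ _ _ lsw); apply: eq_bigr => i _.
  rewrite (linear_sumf _ _ _ lsw); apply: eq_bigr => j _.
  rewrite (linearZf _ _ lsw) uP.1 // scaler_sumr; apply: eq_bigr => k _.
  by rewrite (linearZf _ _ (fb.1 _)).
move=> _ /mapP[p _ ->] /=; split; last exact: coefs_mem.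
by apply: subspaceZ; [exact: coefs_subspace | exact: coefs_mem].
Qed.

Lemma subcoalgebra_swl (B : set H) (tau : H -> C) x : subcoalgebra X B ->
  linear (tau : H -> C^o) -> B x -> B (sw x (fun a b => tau a *: b)).
Proof.
move=> [/submodP sB Bsw] lt /Bsw[s /tensor_eq_bilin E sP].
rewrite /sw (E _ (fun a b => tau a *: b)); last by lin.
by rewrite big_seq; apply: subspace_sum => // p /sP[_ Bp]; apply: subspaceZ.
Qed.

Lemma subcoalgebra_swr (B : set H) (tau : H -> C) x : subcoalgebra X B ->
  linear (tau : H -> C^o) -> B x -> B (sw x (fun a b => tau b *: a)).
Proof.
move=> [/submodP sB Bsw] lt /Bsw[s /tensor_eq_bilin E sP].
rewrite /sw (E _ (fun a b => tau b *: a)); last by lin.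
by rewrite big_seq; apply: subspace_sum => // p /sP[Bp _]; apply: subspaceZ.
Qed.

Lemma haar_mul_linear z : linear ((fun x => psi (x * z)) : H -> C^o).
Proof. by move=> a x y; rewrite mulrDl -scalerAl linearP. Qed.

(** Slicing [x] on the right and then on the left with the functionals of [irrep_dual] leaves a
    nonzero multiple of any prescribed entry, and slices stay in a subcoalgebra. *)
Lemma irrep_sub n (u : 'I_n -> 'I_n -> H) (B : set H) x : irrep X u ->
  subcoalgebra X B -> B x -> coefs u x -> x != 0 -> coefs u `<=` B.
Proof.
move=> uI sB Bx [c xE] x0; have [_ [uP _] _] := uI.
have sB' : subspace B by case: sB => /submodP.
have [i0 [j0 c0]] : exists i0 j0, c i0 j0 != 0.
  apply: contrapT => /forallNP c0; move/eqP: x0; apply.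
  rewrite xE big1 // => i _; rewrite big1 // => j _.
  have [->|cij] := eqVneq (c i j) 0; first by rewrite scale0r.
  by case: (c0 i); exists j.
apply: coefs_sum => // l k.
have [z zE] := irrep_dual cqgX spanU psiP uI k j0.
have [z' z'E] := irrep_dual cqgX spanU psiP uI i0 l.
have step : B (\sum_i c i j0 *: u i k).
  have := subcoalgebra_swr sB (haar_mul_linear (S z)) Bx.
  have lsw : linear (fun x => sw x (fun a b => psi (b * S z) *: a)) by lin.
  rewrite xE (linear_sumf _ _ _ lsw); congr B; apply: eq_bigr => i _.
  rewrite (linear_sumf _ _ _ lsw) (sum_only (j := j0)) => [|j /negPf jj0].
    rewrite (linearZf _ _ lsw) uP.1; last by lin.
    rewrite (sum_only (j := k)) => [|m /negPf mk].
      by rewrite zE !eqxx mulr1 scale1r.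
    by rewrite zE mk mul0r scale0r.
  rewrite (linearZf _ _ lsw) uP.1; last by lin.
  by rewrite big1 ?scaler0 // => m _; rewrite zE jj0 mulr0 scale0r.
have := subcoalgebra_swl sB (haar_mul_linear (S z')) step.
have lsw : linear (fun x => sw x (fun a b => psi (a * S z') *: b)) by lin.
rewrite (linear_sumf _ _ _ lsw) (sum_only (j := i0)) => [|i /negPf ii0].
  rewrite (linearZf _ _ lsw) uP.1; last by lin.
  rewrite (sum_only (j := l)) => [|m /negPf ml]; last first.
    by rewrite z'E ml mulr0 scale0r.
  rewrite z'E !eqxx mulr1 scale1r => Bc.
  by rewrite -[u l k]scale1r -(mulVf c0) -scalerA; apply: subspaceZ.
rewrite (linearZf _ _ lsw) uP.1; last by lin.
by rewrite big1 ?scaler0 // => m _; rewrite z'E ii0 mul0r scale0r.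
Qed.

Definition component (A : set H) : Prop :=
  exists n (u : 'I_n -> 'I_n -> H), irrep X u /\ A = coefs u.

Lemma component_subcoalgebra A : component A -> subcoalgebra X A.
Proof. by move=> [n [u [[_ [uP _] _] ->]]]; apply: coefs_subcoalgebra. Qed.

Lemma component_subspace A : component A -> subspace A.
Proof. by move=> [n [u [_ ->]]]; apply: coefs_subspace. Qed.

Lemma component_sub A B x : component A -> subcoalgebra X B ->
  A x -> B x -> x != 0 -> A `<=` B.
Proof.
by move=> [n [u [uI ->]]] sB Ax Bx x0; apply: (irrep_sub uI sB Bx Ax x0).
Qed.

Lemma component_simple A : component A -> simple_subcoalgebra X A.
Proof.
move=> cA; split; first exact: component_subcoalgebra.
  have [n [u [[n0 [[_ ue] _] _] ->]]] := cA => A0.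
  have := coefs_mem u (Ordinal n0) (Ordinal n0); rewrite A0 => /= u0.
  have := ue (Ordinal n0) (Ordinal n0); rewrite u0 linear0 eqxx => /esym/eqP.
  by rewrite oner_eq0.
move=> B sB BA; have sB' : subspace B by case: sB => /submodP.
have [[x [Bx x0]]|B0] := pselect (exists x, B x /\ x != 0).
  right; apply/seteqP; split=> //.
  exact: (component_sub cA sB (BA _ Bx) Bx x0).
left; apply/seteqP; split=> [x Bx|_ ->]; last by case: sB'.
by apply/eqP; apply: contra_notT B0 => x0; exists x.
Qed.

Lemma component_circ A x : component A -> A x -> A (circ X x).
Proof.
move=> [n [u [[_ [_ uU] _] ->]]] [c ->].
rewrite circ_sum; apply: subspace_sum => [|i _]; first exact: coefs_subspace.
rewrite circ_sum; apply: subspace_sum => [|j _]; first exact: coefs_subspace.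
rewrite circZ uU; apply: subspaceZ; [exact: coefs_subspace|exact: coefs_mem].
Qed.

(** The slice [z] lies in [B], and in [A] by [haar_translater]; its counit is $\psi(b S(a)) \neq 0$.
    So [A] and [B] share a nonzero vector. *)
Lemma sub_of_haar_mul A B a b : component A -> subcoalgebra X B ->
  A a -> B b -> psi (b * S a) != 0 -> A `<=` B.
Proof.
move=> cA sB Aa Bb ab.
pose z := sw b (fun p q => psi (q * S a) *: p).
have lz : linear ((fun x => psi (x * S a)) : H -> C^o) by exact: haar_mul_linear.
have Bz : B z by apply: (subcoalgebra_swr sB lz Bb).
have Az : A z.
  rewrite /z (haar_translater spanU psiP).
  apply: (subcoalgebra_swl (tau := fun p => psi (b * S p))) => //.
    exact: component_subcoalgebra.
  by move=> c x y; rewrite linearP mulrDr -scalerAr linearP.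
apply: (component_sub cA sB Az Bz); apply: contraNneq ab => z0.
have : eps z = 0 by rewrite z0 linear0.
rewrite /z (@sw_linear _ _ X _ C^o eps); last exact: lin_scalar.
under eq_sw => p q do rewrite linearZ /= mulrC.
move=> <-; apply/eqP; symmetry.
by apply: (@sw_counitl _ _ X C^o (fun q => psi (q * S a)) b lz).
Qed.

Lemma sub_of_mul_haar A B a b : component A -> subcoalgebra X B ->
  A a -> B b -> psi (S b * a) != 0 -> A `<=` B.
Proof.
move=> cA sB Aa Bb ab.
pose z := sw b (fun p q => psi (S q * a) *: p).
have lz : linear ((fun x => psi (S x * a)) : H -> C^o).
  by move=> c x y; rewrite linearP mulrDl -scalerAl linearP.
have Bz : B z by apply: (subcoalgebra_swr (tau := fun x => psi (S x * a)) sB lz Bb).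
have Az : A z.
  rewrite /z -(haar_translatel spanU psiP).
  apply: (subcoalgebra_swl (tau := fun p => psi (S b * p))) => //.
    exact: component_subcoalgebra.
  by move=> c x y; rewrite mulrDr -scalerAr linearP.
apply: (component_sub cA sB Az Bz); apply: contraNneq ab => z0.
have : eps z = 0 by rewrite z0 linear0.
rewrite /z (@sw_linear _ _ X _ C^o eps); last exact: lin_scalar.
under eq_sw => p q do rewrite linearZ /= mulrC.
move=> <-; apply/eqP; symmetry.
by apply: (@sw_counitl _ _ X C^o (fun q => psi (S q * a)) b lz).
Qed.

Lemma component_eq A B : component A -> component B -> A `<=` B -> A = B.
Proof.
move=> cA cB AB; have [_ A0 _] := component_simple cA.
have [_ _ /(_ A (component_subcoalgebra cA) AB)[]//] := component_simple cB.
Qed.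

(** Distinct components are thus orthogonal for both [haar_form] and [integral_form], components
    being stable under [circ]. *)
Lemma component_orth A B a b : component A -> component B -> A <> B ->
  A a -> B b -> psi (b * S a) = 0 /\ psi (S b * a) = 0.
Proof.
move=> cA cB AB Aa Bb; have sB := component_subcoalgebra cB; split;
  apply/eqP; apply: contra_notT AB => ab; apply: component_eq => //.
  exact: (sub_of_haar_mul cA sB Aa Bb ab).
exact: (sub_of_mul_haar cA sB Aa Bb ab).
Qed.

(** * Positivity of the Haar form and description of the simple components *)

Local Notation rform := (haar_form X psi).

Let rform_sym := haar_form_sym spanU psiP.

Lemma rformDl x y z : rform (x + y) z = rform x z + rform y z.
Proof. by rewrite /haar_form mulrDl linearD. Qed.

Lemma rform0l z : rform 0 z = 0.
Proof. by rewrite /haar_form mul0r linear0. Qed.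

Lemma component_gt0 A x : component A -> A x -> x != 0 -> 0 < rform x x.
Proof.
move=> [n [u [uI ->]]] [c xE] x0.
have [[i [j cij]]|c0] := pselect (exists i j, c i j != 0).
  by rewrite xE; apply: (irrep_form_gt0 cqgX spanU psiP uI cij).
move: x0; rewrite xE big1 ?eqxx // => i _; rewrite big1 // => j _.
have [->|cij] := eqVneq (c i j) 0; first by rewrite scale0r.
by case: c0; exists i, j.
Qed.

Fixpoint sum_of (L : seq (set H)) (x : H) : Prop :=
  if L is A :: L' then exists a y, [/\ A a, sum_of L' y & x = a + y] else x = 0.

Fixpoint all_component (L : seq (set H)) : Prop :=
  if L is A :: L' then component A /\ all_component L' else True.

Fixpoint occurs (A : set H) (L : seq (set H)) : Prop :=
  if L is B :: L' then A = B \/ occurs A L' else False.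

Lemma sum_of_subspace L : all_component L -> subspace (sum_of L).
Proof.
elim: L => [|A L IH] /=.
  by move=> _; split=> // a x y -> ->; rewrite scaler0 addr0.
move=> [cA /IH sL]; have sA := component_subspace cA; split.
  by exists 0, 0; split; [case: sA|case: sL|rewrite addr0].
move=> c x y [a [z [Aa Lz ->]]] [b [t [Ab Lt ->]]].
exists (c *: a + b), (c *: z + t); split; [by apply: sA.2|by apply: sL.2|].
by rewrite scalerDr addrACA.
Qed.

Lemma sum_of_occurs A L a : all_component L -> occurs A L -> A a -> sum_of L a.
Proof.
elim: L => //= B L IH [cB cL] [<-|AL] Aa.
  by exists a, 0; split; [|case: (sum_of_subspace cL)|rewrite addr0].
exists 0, a; split; [|exact: IH|by rewrite add0r].
by case: (component_subspace cB).
Qed.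

Lemma rform_sum_of0 A L a y : component A -> all_component L -> ~ occurs A L ->
  A a -> sum_of L y -> rform y a = 0.
Proof.
move=> cA; elim: L y => [|B L IH] y /=; first by move=> _ _ _ ->; rewrite rform0l.
move=> [cB cL] /not_orP[AB AL] Aa [b [z [Bb Lz ->]]].
rewrite rformDl (IH z) // addr0.
by have [] := component_orth cA cB AB (component_circ cA Aa) Bb.
Qed.

(** Lists may repeat a component: a repeated head is absorbed into the tail, and otherwise it is
    orthogonal to the tail and the two norms add. *)
Lemma sum_of_gt0 L x : all_component L -> sum_of L x -> x != 0 -> 0 < rform x x.
Proof.
elim: L x => [|A L IH] x /=; first by move=> _ ->; rewrite eqxx.
move=> [cA cL] [a [y [Aa Ly ->]]] ay0.
have [AL|AL] := pselect (occurs A L).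
  apply: IH => //; apply: subspaceD => //; first exact: sum_of_subspace.
  exact: sum_of_occurs AL Aa.
have ya : rform y a = 0 by exact: (rform_sum_of0 cA cL AL Aa Ly).
have ay : rform a y = 0 by rewrite rform_sym ya conjC0.
rewrite rformDl rform_sym rformDl [rform y (a + y)]rform_sym rformDl ay ya.
rewrite addr0 add0r -!rform_sym.
have [a0|a0] := eqVneq a 0.
  rewrite a0 rform0l add0r; apply: IH => //.
  by move: ay0; rewrite a0 add0r.
apply: ltr_pwDl; first exact: (component_gt0 cA Aa a0).
have [->|y0] := eqVneq y 0; first by rewrite rform0l.
exact/ltW/IH.
Qed.

Lemma rform_gt0 x : x != 0 -> 0 < rform x x.
Proof.
suff [L [cL Lx]] : exists L, all_component L /\ sum_of L x.
  exact: sum_of_gt0 Lx.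
apply: (irrep_ind spanU (P := fun x => exists L, all_component L /\ sum_of L x)).
  split; first by exists [::].
  move=> a {}x y [L [cL Lx]] [L' [cL' Ly]].
  have [cLL [L0 L1]] : all_component (L ++ L') /\
      (forall x, sum_of L x -> sum_of (L ++ L') x) /\
      (forall x, sum_of L' x -> sum_of (L ++ L') x).
    elim: L cL {Lx} => [|A L IH] /=.
      by move=> _; split=> //; split=> // z ->; case: (sum_of_subspace cL').
    move=> [cA /IH[cLL [L0 L1]]]; split=> //; split.
      by move=> z [b [t [Ab Lt ->]]]; exists b, t; split=> //; apply: L0.
    move=> z L'z; exists 0, z; split; [|exact: L1|by rewrite add0r].
    by case: (component_subspace cA).
  exists (L ++ L'); split=> //; apply: (sum_of_subspace cLL).2; first exact: L0.
  exact: L1.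
move=> n u uI i j; exists [:: coefs u]; split; first by split=> //; exists n, u.
by exists (u i j), 0; split; [exact: coefs_mem| |rewrite addr0].
Qed.

Lemma rform_inner_product : inner_product rform.
Proof.
by split; [exact: (haar_form_hermitian spanU psiP)|exact: rform_gt0].
Qed.

(** A nonzero vector of [A] has positive norm, so it is not orthogonal to all irreducible entries;
    some component then lies in [A] and simplicity forces equality. *)
Lemma simple_component A : simple_subcoalgebra X A -> component A.
Proof.
move=> [sA A0 Asimple]; have sA' : subspace A by case: sA => /submodP.
have [a [Aa a0]] : exists a, A a /\ a != 0.
  apply: contrapT => /forallNP An; apply: A0; apply/seteqP; split=> [x Ax|_ ->].
    by apply/eqP; apply: contrapT => /negP x0; apply: (An x).
  by case: sA'.
have /existsNP[n /existsNP[u /not_implyP[uI /existsNP[i /existsNP[j aij]]]]] :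
  ~ (forall n (u : 'I_n -> 'I_n -> H), irrep X u ->
       forall i j, psi (a * S (circ X (u i j))) = 0).
  move=> aU; have := rform_gt0 a0; rewrite /haar_form.
  rewrite (irrep_ind spanU (P := fun x => psi (a * S (circ X x)) = 0)) ?ltxx //.
  split; first by rewrite circ0 linear0 mulr0 linear0.
  move=> c x y x0 y0.
  by rewrite circP linearP mulrDr -scalerAr linearP /= x0 y0 mulr0 addr0.
have cU : component (coefs u) by exists n, u.
have UA : coefs u `<=` A.
  apply: (sub_of_haar_mul cU sA _ Aa); last by apply/eqP; exact: aij.
  by apply: component_circ => //; exact: coefs_mem.
have [U0|<- //] := Asimple _ (component_subcoalgebra cU) UA.
by have [_ []] := component_simple cU.
Qed.

Lemma normal_integral_haar (phi : {scalar H}) : normal_integral X phi ->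
  forall x, phi x = psi x.
Proof.
have [psi1 _ psir _] := psiP.
move=> [phi1 phi0]; apply: (irrep_ind spanU).
  split=> [|a x y xE yE]; first by rewrite !linear0.
  by rewrite !linearP /= xE yE.
move=> n u uI i j; have cU : component (coefs u) by exists n, u.
pose C1 := range (fun a : C => a%:A : H).
have sC1 : subcoalgebra X C1.
  split.
    apply/submodP; split; first by exists 0; rewrite ?scale0r.
    move=> a _ _ [b _ <-] [c _ <-].
    by exists (a * b + c); rewrite // scalerDl scalerA.
  move=> _ [a _ <-]; exists [:: (a%:A, 1)].
    apply/tensor_eq_bilin => W f fb.
    rewrite big_seq1 (linearZf _ _ (fb.1 _)) [LHS](linearZf _ _ (lin_sw X fb)).
    by rewrite sw1.
  move=> p; rewrite inE => /eqP->; split; first by exists a.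
  by exists 1; rewrite // scale1r.
have [UC|UC] := pselect (coefs u = C1).
  have [a _ <-] : C1 (u i j) by rewrite -UC; exact: coefs_mem.
  by rewrite !linearZ /= phi1 psi1.
rewrite (phi0 _ (component_simple cU) UC _ (coefs_mem u i j)).
apply/esym/eqP; apply: contra_notT UC => uij.
(* A nonzero value of [psi] puts [1] in the component: the slice of $u_{ij}$ by [psi] is
   $\psi(u_{ij}) 1$. *)
have U1 : coefs u 1.
  rewrite -[1]scale1r -(mulVf uij) -scalerA; apply: subspaceZ.
    exact: coefs_subspace.
  rewrite -psir; apply: subcoalgebra_swl; last exact: coefs_mem.
    exact: component_subcoalgebra.
  exact: lin_scalar.
apply/seteqP; split.
  apply: (component_sub cU sC1 U1); last exact: oner_neq0.
  by exists 1; rewrite // scale1r.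
by move=> _ [a _ <-]; apply: subspaceZ => //; exact: coefs_subspace.
Qed.

(* The sum of the components different from [A], as a smallest subspace. *)
Definition other_components (A : set H) (x : H) : Prop :=
  forall P : H -> Prop, subspace P ->
    (forall B, component B -> B <> A -> B `<=` P) -> P x.

Lemma other_components_subspace A : subspace (other_components A).
Proof.
split=> [P [P0 _] _ //|a x y Ax Ay P sP AP].
by apply: sP.2; [exact: Ax|exact: Ay].
Qed.

Lemma other_components_sub A B : component B -> B <> A ->
  B `<=` other_components A.
Proof. by move=> cB BA x Bx P sP /(_ B cB BA); apply. Qed.

Lemma component_decomposition A x : component A ->
  exists a y, [/\ A a, other_components A y & x = a + y].
Proof.
move=> cA; have sA := component_subspace cA.
have sO := other_components_subspace A.
apply: (irrep_ind spanU
  (P := fun x => exists a y, [/\ A a, other_components A y & x = a + y])).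
  split; first by exists 0, 0; split; [case: sA|case: sO|rewrite addr0].
  move=> c {}x y [a [z [Aa Oz ->]]] [b [t [Ab Ot ->]]].
  exists (c *: a + b), (c *: z + t); split; [exact: sA.2|exact: sO.2|].
  by rewrite scalerDr addrACA.
move=> n u uI i j; have cU : component (coefs u) by exists n, u.
have [UA|UA] := pselect (coefs u = A).
  exists (u i j), 0; split; [|by case: sO|by rewrite addr0].
  by rewrite -UA; exact: coefs_mem.
exists 0, (u i j); split; [by case: sA| |by rewrite add0r].
exact: (other_components_sub cU UA (coefs_mem _ _ _)).
Qed.

Lemma other_components_orth A a y : component A -> A a ->
  other_components A y -> psi (a * S (circ X y)) = 0 /\ psi (S (circ X y) * a) = 0.
Proof.
move=> cA Aa Oy; apply: (Oy (fun y => psi (a * S (circ X y)) = 0 /\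
  psi (S (circ X y) * a) = 0)).
  split=> [|c x z [x1 x2] [z1 z2]].
    by rewrite circ0 linear0 mulr0 mul0r linear0.
  rewrite circP linearP mulrDr mulrDl -scalerAr -scalerAl !linearP /=.
  by rewrite x1 x2 z1 z2 mulr0 addr0.
move=> B cB BA x /(component_circ cB) Bx; split.
  by have [] := component_orth cB cA BA Bx Aa.
by have [] := component_orth cA cB (nesym BA) Aa Bx.
Qed.

Lemma rform_eq0 x : rform x x = 0 -> x = 0.
Proof.
move=> x0; apply/eqP; apply: contraT => /rform_gt0.
by rewrite x0 ltxx.
Qed.

(** * The Nakayama automorphism *)

Variable N : {lrmorphism H -> H}.
Hypothesis NP : nakayama_automorphism psi N.

Lemma nakayamaE x y : psi (x * y) = psi (y * N x).
Proof. exact: NP.2. Qed.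

Lemma nakayama_inj : injective N.
Proof. by case: NP => /bij_inj. Qed.

Lemma nakayama_surj y : exists x, N x = y.
Proof. by case: NP => -[g _ gK] _; exists (g y). Qed.

Lemma integral_form_nakayama x y : integral_form X psi (N x) y = rform x y.
Proof. by rewrite /integral_form -nakayamaE. Qed.

Lemma nakayama_selfadjoint x y :
  integral_form X psi (N x) y = integral_form X psi x (N y).
Proof.
rewrite integral_form_nakayama (integral_form_sym spanU psiP).
by rewrite integral_form_nakayama rform_sym.
Qed.

(** With $w = a + y$, one has $[y,y] = \langle N w, y\rangle - [a,y]$, and both terms vanish by
    orthogonality. Starting with preimages lets positivity of [haar_form] suffice. *)
Lemma nakayama_component_inv A w : component A -> A (N w) -> A w.
Proof.
move=> cA Aw; have [a [y [Aa Oy wE]]] := component_decomposition w cA.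
suff y0 : y = 0 by rewrite wE y0 addr0.
apply: rform_eq0; rewrite -integral_form_nakayama.
have -> : N y = N w - N a by rewrite wE linearD /= addrC addKr.
rewrite /integral_form mulrBr linearB /= -(nakayamaE a).
have [_ ->] := other_components_orth cA Aw Oy.
by have [-> _] := other_components_orth cA Aa Oy; rewrite subrr.
Qed.

Lemma nakayama_other_inv A w : component A -> other_components A (N w) ->
  other_components A w.
Proof.
move=> cA Ow; have sO := other_components_subspace A.
(* Minimality is applied to the subspace of vectors all of whose preimages lie in the other
   components; surjectivity of [N] makes it closed under sums. *)
apply: (Ow (fun z => forall w, N w = z -> other_components A w)) (erefl _).
  split=> [v|c x y xP yP v vE].
    by rewrite -(linear0 N) => /nakayama_inj ->; case: sO.
  have [x' x'E] := nakayama_surj x; have [y' y'E] := nakayama_surj y.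
  have -> : v = c *: x' + y'.
    by apply: nakayama_inj; rewrite vE linearP /= x'E y'E.
  by apply: sO.2; [exact: xP|exact: yP].
move=> B cB BA x Bx v vE; apply: (other_components_sub cB BA).
by apply: nakayama_component_inv; rewrite ?vE.
Qed.

(** Decompose [N x] and pull back both parts: the part of [x] outside [A] also lies in [A], hence is
    orthogonal to itself. *)
Lemma nakayama_component A x : component A -> A x -> A (N x).
Proof.
move=> cA Ax; have sA := component_subspace cA.
have [a [y [Aa Oy NE]]] := component_decomposition (N x) cA.
have [a' a'E] := nakayama_surj a; have [y' y'E] := nakayama_surj y.
have xE : x = a' + y' by apply: nakayama_inj; rewrite NE linearD /= a'E y'E.
have Oy' : other_components A y' by apply: nakayama_other_inv; rewrite ?y'E.
have Aa' : A a' by apply: nakayama_component_inv; rewrite ?a'E.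
have Ay' : A y' by rewrite -[y'](addKr a') -xE addrC; apply: subspaceB.
have y'0 : y' = 0.
  by apply: rform_eq0; have [] := other_components_orth cA Ay' Oy'.
by rewrite NE -y'E y'0 linear0 addr0.
Qed.

Lemma nakayama_image A : component A -> N @` A = A.
Proof.
move=> cA; apply/seteqP; split=> [_ [x Ax <-]|x Ax].
  exact: nakayama_component.
have [w wE] := nakayama_surj x; exists w => //.
by apply: nakayama_component_inv; rewrite ?wE.
Qed.

Lemma haar_nondegenerate w w' : (forall z, psi (z * w) = psi (z * w')) -> w = w'.
Proof.
move=> ww'; apply/eqP; rewrite -subr_eq0; apply/eqP/rform_eq0.
have [z zE] := nakayama_surj (S (circ X (w - w'))).
by rewrite /haar_form -zE -nakayamaE mulrBr linearB /= ww' subrr.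
Qed.

(** Conjugating $\psi(x z^\circ) = \psi(z^\circ N(x))$ shows that both sides pair equally with every
    [z]. *)
Lemma nakayama_circ x : N (circ X x) = circ X (N x).
Proof.
have [_ _ _ psic] := psiP.
apply: haar_nondegenerate => z; rewrite -nakayamaE.
rewrite -[z](circK X) -!circM !psic; congr (_^*).
exact: nakayamaE.
Qed.

Lemma star_modular x : star_id X (modular_function X N) x = S (S (N x)).
Proof.
(* Apply [S] to [haar_translate] at [N x], then use the Nakayama identity, [haar_translate] again,
   and the Nakayama identity once more. *)
have Ey y : sw (N x) (fun a b => psi (y * a) *: S (S b)) =
            sw x (fun a b => psi (y * N a) *: b).
  have := congr1 S (haar_translate spanU psiP y (N x)).
  rewrite !(sw_linear _ _ _ (lin_fun _)).
  under eq_sw => a b do rewrite -nakayamaE linearZ /=.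
  rewrite -(haar_translate spanU psiP x y).
  under eq_sw => a b do rewrite nakayamaE.
  by under [RHS]eq_sw => a b do rewrite linearZ /=; move=> ->.
(* It remains to replace $\psi(y\,\cdot)$ by the counit. Riesz does this on the finitely many first
   legs of both sums, [y] being chosen with $N(y) = S(w^\circ)$. *)
have [w wP] := riesz rform_inner_product
  ([seq p.1 | p <- comul X (N x)] ++ [seq N p.1 | p <- comul X x])
  (lin_scalar eps).
have [y yE] := nakayama_surj (S (circ X w)).
have epsE a : rform a w = psi (y * a) by rewrite /haar_form -yE -nakayamaE.
have := Ey y; rewrite /star_id /modular_function => E.
transitivity (sw x (fun a b => psi (y * N a) *: b)).
  rewrite /sw !big_seq; apply: eq_bigr => p px; rewrite -epsE wP //.
  by rewrite mem_cat; apply/orP; right; apply/mapP; exists p.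
rewrite -E.
rewrite -(@sw_counitl _ _ X _ (fun b => S (S b)) (N x)); last first.
  exact: (lin_comp (lin_fun _) (lin_fun _)).
rewrite /sw !big_seq; apply: eq_bigr => p px; rewrite -epsE wP //.
by rewrite mem_cat; apply/orP; left; apply/mapP; exists p.
Qed.

(** With $\alpha \star \mathrm{id} = S^2 N$, two uses of $\psi S = \psi$ strip the antipodes and
    leave $\psi(x S(y)^\circ)$. *)
Lemma integral_form_star_modular x y :
  integral_form X psi (star_id X (modular_function X N) x) y =
  rform (circ X y) (circ X x).
Proof.
have [_ _ _ psic] := psiP.
rewrite star_modular /integral_form -(antipodeM spanU) (haar_antipode spanU psiP).
have Sy : S (circ X (S y)) = circ X y.
  by have := antipode_circK spanU (circ X y); rewrite (circK X).
rewrite -{1}Sy -(antipodeM spanU) (haar_antipode spanU psiP) -nakayamaE.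
by rewrite rform_sym /haar_form circK -psic circM circK.
Qed.

End Components.

Theorem lemma8p9 (R : realType) (H : algType R[i]) (X : circ_hopf_algebra H)
    (cqgX : compact_quantum_group X)
    (phi : {scalar H}) (phiP : normal_integral X phi)
    (N : {lrmorphism H -> H}) (NP : nakayama_automorphism phi N) :
  [/\ positive_operator (integral_form X phi) N /\
        (forall A : set H, simple_subcoalgebra X A -> N @` A = A),
      forall x : H, N (circ X x) = circ X (N x)
    & positive_operator (integral_form X phi)
        (star_id X (modular_function X N))].
Proof.
have [ip ipP ipU] := regular_form cqgX.
have spanU := span_ucorep ipP ipU.
have [psi psiP] := haar_exists ipP ipU.
have phiE := normal_integral_haar cqgX spanU psiP phiP.
(* From here every result proved for a Haar functional applies to [phi] itself. *)
have {phiE}phiH : haar X phi.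
  case: psiP => psi1 psil psir psic; split=> [|x|x|x]; rewrite ?phiE //.
    by under eq_sw => a b do rewrite phiE.
  by under eq_sw => a b do rewrite phiE.
have circ_neq0 x : x != 0 -> circ X x != 0.
  by apply: contra_neq => x0; rewrite -[x](circK X) x0 circ0.
split; [split; [split|]| |split].
- exact: linearP.
- exact: (nakayama_selfadjoint spanU phiH NP).
- move=> x x0; rewrite (integral_form_nakayama X NP).
  exact: (rform_gt0 cqgX spanU phiH).
- move=> A /(simple_component cqgX spanU phiH).
  exact: (nakayama_image cqgX spanU phiH NP).
- exact: (nakayama_circ cqgX spanU phiH NP).
- move=> a x y.
  by rewrite !(star_modular cqgX spanU phiH NP) !linearP.
- move=> x y; rewrite (integral_form_star_modular cqgX spanU phiH NP).
  rewrite (integral_form_sym spanU phiH).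
  rewrite (integral_form_star_modular cqgX spanU phiH NP).
  by rewrite [LHS](haar_form_sym spanU phiH).
- move=> x x0; rewrite (integral_form_star_modular cqgX spanU phiH NP).
  exact/(rform_gt0 cqgX spanU phiH)/circ_neq0.
Qed.
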